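(* Let $K$ be a lattice that can be expressed as a direct union of countably many lattices $K_i$ such that every congruence semilattice $\mathrm{Con}_{\mathrm c}\,K_i$ is conditionally co-Brouwerian. Then $K$ embeds congruence-preservingly into some relatively complemented lattice $L$, which it generates as a convex sublattice.
   Context: A direct union is a union of an upward directed family of sublattices. For a lattice $M$, $\mathrm{Con}_{\mathrm c}\,M$ denotes the join-semilattice with zero of compact (i.e., finitely generated) congruences of $M$. A lattice embedding $f\colon K\hookrightarrow L$ is congruence-preserving if the induced map $\mathrm{Con}_{\mathrm c}\,f\colon\mathrm{Con}_{\mathrm c}\,K\to\mathrm{Con}_{\mathrm c}\,L$, sending a compact congruence $\boldsymbol a$ to the congruence of $L$ generated by the image of $\boldsymbol a$ under $f$, is an isomorphism (equivalently, every congruence of $K$ extends to exactly one congruence of $L$). A $\langle\vee,0\rangle$-semilattice (join-semilattice with least element $0$) is co-Brouwerian if it is a complete lattice satisfying $a\vee\bigwedge_{i\in I}x_i=\bigwedge_{i\in I}(a\vee x_i)$ for all elements $a$ and families $(x_i)_{i\in I}$; it is conditionally co-Brouwerian if each of its principal ideals is co-Brouwerian. *)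

(* Defs.v *)
From HB Require Import structures.
From mathcomp Require Import all_boot all_order.
From mathcomp Require Import boolp classical_sets.

Set Implicit Arguments.
Unset Strict Implicit.
Unset Printing Implicit Defensive.

Import Order.TTheory.
Local Open Scope order_scope.

Section Congruences.
Context {d : Order.disp_t} {K : latticeType d}.

Record congruence (theta : K -> K -> Prop) : Prop := Congruence {
  congr_refl : forall x, theta x x;
  congr_sym : forall x y, theta x y -> theta y x;
  congr_trans : forall x y z, theta x y -> theta y z -> theta x z;
  congr_meet : forall x x' y y',
    theta x x' -> theta y y' -> theta (x `&` y) (x' `&` y');
  congr_join : forall x x' y y',
    theta x x' -> theta y y' -> theta (x `|` y) (x' `|` y') }.

Definition con_gen (R : K -> K -> Prop) (x y : K) : Prop :=
  forall theta, congruence theta -> (forall u v, R u v -> theta u v) ->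
  theta x y.

Definition fin_gen (theta : K -> K -> Prop) : Prop :=
  exists s : seq (K * K), theta = con_gen (fun x y => (x, y) \in s).

Lemma con_gen_sub (R : K -> K -> Prop) x y : R x y -> con_gen R x y.
Proof. by move=> Rxy theta _; apply. Qed.

Lemma con_gen_min (R theta : K -> K -> Prop) : congruence theta ->
  (forall u v, R u v -> theta u v) -> forall x y, con_gen R x y -> theta x y.
Proof. by move=> ct Rt x y; apply. Qed.

Lemma con_gen_congruence (R : K -> K -> Prop) : congruence (con_gen R).
Proof.
split.
- by move=> x t ct _; apply: (congr_refl ct).
- by move=> x y h t ct Rt; apply: congr_sym (h t ct Rt).
- by move=> x y z h1 h2 t ct Rt; apply: congr_trans (h1 t ct Rt) (h2 t ct Rt).
- by move=> x x' y y' h1 h2 t ct Rt;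
    apply: congr_meet (h1 t ct Rt) (h2 t ct Rt).
- by move=> x x' y y' h1 h2 t ct Rt;
    apply: congr_join (h1 t ct Rt) (h2 t ct Rt).
Qed.

Lemma con_gen_eq (R R' : K -> K -> Prop) :
  (forall x y, R x y -> con_gen R' x y) ->
  (forall x y, R' x y -> con_gen R x y) -> con_gen R = con_gen R'.
Proof.
move=> RR' R'R; apply/funext => x; apply/funext => y; apply/propext; split.
  exact: (con_gen_min (con_gen_congruence _)) RR' _ _.
exact: (con_gen_min (con_gen_congruence _)) R'R _ _.
Qed.

End Congruences.

Record conc d (K : latticeType d) := Conc {
  conc_rel :> K -> K -> Prop;
  conc_congruence : congruence conc_rel;
  conc_fin_gen : fin_gen conc_rel }.

Fact conc_display : Order.disp_t. Proof. exact: Order.Disp tt tt. Qed.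

Section ConcSemilattice.
Context {d : Order.disp_t} {K : latticeType d}.
Implicit Types a b c : conc K.

HB.instance Definition _ := gen_eqMixin (conc K).
HB.instance Definition _ := gen_choiceMixin (conc K).

Lemma conc_inj a b : (a : K -> K -> Prop) = b -> a = b.
Proof.
case: a b => [r cr fr] [r' cr' fr'] /= E; case: r' / E cr' fr' => cr' fr'.
by congr Conc; apply: Prop_irrelevance.
Qed.

Definition conc_le a b : bool := `[< forall x y, a x y -> b x y >].

Fact conc_le_refl : reflexive conc_le.
Proof. by move=> a; apply/asboolP. Qed.

Fact conc_le_anti : antisymmetric conc_le.
Proof.
move=> a b /andP[/asboolP ab /asboolP ba]; apply: conc_inj.
by apply/funext => x; apply/funext => y; apply/propext; split; auto.
Qed.

Fact conc_le_trans : transitive conc_le.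
Proof.
by move=> b a c /asboolP ab /asboolP bc; apply/asboolP => x y /ab /bc.
Qed.

HB.instance Definition _ := Order.Le_isPOrder.Build conc_display (conc K)
  conc_le_refl conc_le_anti conc_le_trans.

Fact conc_bot_fin_gen : fin_gen (con_gen (fun _ _ : K => False)).
Proof. by exists [::]; apply: con_gen_eq. Qed.

Definition conc_bot : conc K :=
  Conc (con_gen_congruence _) conc_bot_fin_gen.

Fact conc_le0x a : (conc_bot <= a)%O.
Proof.
by apply/asboolP; apply: con_gen_min => //; apply: conc_congruence.
Qed.

HB.instance Definition _ := Order.hasBottom.Build conc_display (conc K)
  conc_le0x.

Fact conc_join_fin_gen a b : fin_gen (con_gen (fun x y => a x y \/ b x y)).
Proof.
case: (conc_fin_gen a) (conc_fin_gen b) => [s ->] [t ->].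
exists (s ++ t); apply: con_gen_eq => x y.
  by move=> [] h; apply: (con_gen_min (con_gen_congruence _) _ h) => u v uv;
    apply: con_gen_sub; rewrite mem_cat uv ?orbT.
rewrite mem_cat => /orP[] h; apply: con_gen_sub; [left | right];
  exact: con_gen_sub.
Qed.

Definition conc_join a b : conc K :=
  Conc (con_gen_congruence _) (conc_join_fin_gen a b).

Fact conc_leUx a b c : (conc_join a b <= c)%O = (a <= c)%O && (b <= c)%O.
Proof.
apply/asboolP/andP => [h | [/asboolP ac /asboolP bc]].
  split; apply/asboolP => x y xy; apply: (h x y); apply: con_gen_sub => /=;
    by [left | right].
by apply: (con_gen_min (conc_congruence c)) => x y [/ac|/bc].
Qed.

HB.instance Definition _ := Order.POrder_isJoinSemilattice.Build
  conc_display (conc K) conc_leUx.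

End ConcSemilattice.

Section ConcMap.
Context {d d' : Order.disp_t} {K : latticeType d} {L : latticeType d'}.
Variable f : {lmorphism K -> L}.

Definition image_rel (theta : K -> K -> Prop) (u v : L) : Prop :=
  exists x y, [/\ theta x y, u = f x & v = f y].

Fact conc_map_fin_gen (a : conc K) : fin_gen (con_gen (image_rel a)).
Proof.
case: (conc_fin_gen a) => s ->.
exists [seq (f p.1, f p.2) | p <- s]; apply: con_gen_eq => [u v|u v].
  case=> x [y [xy -> ->]].
  pose T := con_gen (fun u v => (u, v) \in [seq (f p.1, f p.2) | p <- s]).
  have cT : congruence T by apply: con_gen_congruence.
  apply: (xy (fun x y => T (f x) (f y))) => [|x' y' s'].
    split.
    - by move=> z; apply: (congr_refl cT).
    - by move=> z z'; apply: (congr_sym cT).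
    - by move=> z z' z''; apply: (congr_trans cT).
    - by move=> z z' w w'; rewrite !omorphI; apply: (congr_meet cT).
    - by move=> z z' w w'; rewrite !omorphU; apply: (congr_join cT).
  by apply: con_gen_sub; apply/mapP; exists (x', y').
case/mapP => -[x y] /= xys [-> ->]; apply: con_gen_sub.
by exists x, y; split=> //; apply: con_gen_sub.
Qed.

Definition conc_map (a : conc K) : conc L :=
  Conc (con_gen_congruence _) (conc_map_fin_gen a).

End ConcMap.

Definition semilattice_iso d (S : bJoinSemilatticeType d)
    d' (T : bJoinSemilatticeType d') (g : S -> T) : Prop :=
  [/\ bijective g, {morph g : x y / x `|` y} & g \bot = \bot].

Definition congruence_preserving d (K : latticeType d)
    d' (L : latticeType d') (f : {lmorphism K -> L}) : Prop :=
  semilattice_iso (conc_map f).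

Definition complete_lattice d (S : porderType d) : Prop :=
  forall A : set S, (exists m, infimums A m) /\ (exists m, supremums A m).

(* By completeness, every family has a meet m, so this is distributivity of
   join over arbitrary (including empty) meets. *)
Definition co_brouwerian d (S : bJoinSemilatticeType d) : Prop :=
  complete_lattice S /\
  forall (a : S) (I : Type) (x : I -> S) (m : S),
    infimums (range x) m ->
    infimums (range (fun i => a `|` x i)) (a `|` m).

Record principal_ideal d (S : bJoinSemilatticeType d) (a : S) := PrincipalIdeal {
  ideal_val :> S;
  _ : ideal_val <= a }.

Section PrincipalIdeal.
Context {d : Order.disp_t} {S : bJoinSemilatticeType d} {a : S}.
Local Notation idl := (principal_ideal a).

HB.instance Definition _ := [isSub for @ideal_val d S a].
HB.instance Definition _ := [Choice of idl by <:].
HB.instance Definition _ := [SubChoice_isSubPOrder of idl by <: with d].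

Definition ideal_bot : idl := PrincipalIdeal (le0x a).

Fact ideal_le0x (x : idl) : (ideal_bot <= x)%O.
Proof. by rewrite -Order.le_val /= le0x. Qed.

HB.instance Definition _ := Order.hasBottom.Build d idl ideal_le0x.

Fact ideal_join_proof (x y : idl) : (x : S) `|` (y : S) <= a.
Proof. by rewrite leUx (valP x) (valP y). Qed.

Definition ideal_join (x y : idl) : idl := PrincipalIdeal (ideal_join_proof x y).

Fact ideal_leUx (x y z : idl) :
  (ideal_join x y <= z)%O = (x <= z)%O && (y <= z)%O.
Proof. by rewrite -!Order.le_val /= leUx. Qed.

HB.instance Definition _ :=
  Order.POrder_isJoinSemilattice.Build d idl ideal_leUx.

End PrincipalIdeal.

Definition conditionally_co_brouwerian d (S : bJoinSemilatticeType d) : Prop :=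
  forall a : S, co_brouwerian (principal_ideal a).

Record sublattice d (K : latticeType d) (S : latticeClosed K) := Sublattice {
  sublattice_val :> K;
  _ : sublattice_val \in S }.

Section Sublattice.
Context {d : Order.disp_t} {K : latticeType d} {S : latticeClosed K}.
Local Notation subl := (sublattice S).

HB.instance Definition _ := [isSub for @sublattice_val d K S].
HB.instance Definition _ := [Choice of subl by <:].

Fact sublattice_meet : {in S &, forall u v : K, u `&` v \in S}.
Proof. exact: (@opredI _ _ S). Qed.

Fact sublattice_join : {in S &, forall u v : K, u `|` v \in S}.
Proof. exact: (@opredU _ _ S). Qed.

HB.instance Definition _ := Order.SubChoice_isSubLattice.Build
  d K (fun x => x \in S) d subl sublattice_meet sublattice_join.

End Sublattice.

Definition direct_union d (K : latticeType d)
    (I : Type) (K_ : I -> latticeClosed K) : Prop :=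
  [/\ inhabited I,
      forall i j, exists k, {subset K_ i <= K_ k} /\ {subset K_ j <= K_ k} &
      forall x : K, exists i, x \in K_ i].

Definition relatively_complemented d (L : latticeType d) : Prop :=
  forall a b x : L, a <= x <= b -> exists y, x `&` y = a /\ x `|` y = b.

Definition convex d (L : latticeType d) (C : {pred L}) : Prop :=
  forall x y z : L, x \in C -> z \in C -> x <= y <= z -> y \in C.

Definition convex_generates d (L : latticeType d) (X : set L) : Prop :=
  forall C : latticeClosed L, convex C -> (forall x, X x -> x \in C) ->
  forall y, y \in C.

(* Main.v *)
(* A congruence-valued order ||x <= y|| in D, vanishing exactly when x <= y,
   turns a lattice into a model in which D, dually a conditionally complete
   Heyting algebra, is the algebra of truth values.  Partial lattices valued
   in D embed into the lattice of their bounded D-valued ideals without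
   changing the values.  Hence one may amalgamate over a common sublattice and
   freely add an element n with n \/ s = j and n /\ t = o whenever the values
   permit.  The case s = t yields relative complements; the case j = s \/ t,
   s /\ t = o, ||t <= o|| <= ||s <= o|| makes the congruence collapsing [o, s]
   collapse [o, t], so that values determine principal congruences.
   Along a chain exhausting K, the n-th stage is valued in Con_c K_n: pass to
   values in Con_c K_{n+1}, amalgamate with K_{n+1} over K_n and add all such
   elements.  The limit is the required lattice, its values lying in Con_c K. *)
Require Import Defs.
From HB Require Import structures.
From mathcomp Require Import all_boot all_order generic_quotient.
From mathcomp Require Import boolp classical_sets.

Set Implicit Arguments.
Unset Strict Implicit.
Unset Printing Implicit Defensive.

Import Order.TTheory.
Local Open Scope order_scope.

(** The obstacle is that nonempty infima are available in each Con_c K_n but perhaps not in Con_c K,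
    and that the maps Con_c K_n -> Con_c K_{n+1} preserve finite joins but in general no infima. So
    every construction that uses infima is carried out with values in a single Con_c K_n, and
    whatever passes to the next stage is expressed by finite joins and inequalities alone. The
    condition for adjoining an element is of this kind, and compactness brings it back from the
    limit to some stage. Countability replaces the direct union by a chain, in which each stage has
    one predecessor to amalgamate over. The bounds on ideals ensure that the comparison of two
    ideals has a value at all; the same bounds make K generate L as a convex sublattice. *)

Ltac join_mem := first [ exact: lexx | exact: le0x | assumption
  | apply: lexUl; join_mem | apply: lexUr; join_mem ].
Ltac join_le := rewrite ?leUx; repeat (apply/andP; split); join_mem.

(** * Infima and distributivity in conditionally co-Brouwerian semilattices *)

Section CoBrouwer.
Context {dD : Order.disp_t} {D : bJoinSemilatticeType dD}.
Implicit Types (a b u w x y : D) (S : set D).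

(** The form in which the hypothesis is used: [a] = [\bot] says that [m] is the infimum of [S], and
    neither [a] nor [w] is confined to a principal ideal. *)
Definition meet_continuous := forall S, (S !=set0)%classic ->
  exists m, lbound S m /\
    forall a w, (forall s, S s -> w <= a `|` s) -> w <= a `|` m.

Hypothesis cob : conditionally_co_brouwerian D.

(** The supremum [m] in the ideal of [b] is least only among the upper bounds below [b]. An
    arbitrary upper bound [u] is compared with the supremum [m'] in the ideal of b \/ u, which lies
    below both [b] and [u]. *)
Let bounded_sup S b : ubound S b -> (supremums S !=set0)%classic.
Proof.
move=> Sb.
pose T c : set (principal_ideal c) := [set e | S (e : D)]%classic.
have [_ [m [mub mlub]]] := (cob b).1 (T b).
have mS e : S e -> e <= ideal_val m.
  by move=> Se; have := mub (PrincipalIdeal (Sb _ Se)) Se; rewrite -Order.le_val.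
exists (ideal_val m); split=> [e|u Su]; first exact: mS.
have [_ [m' [m'ub m'lub]]] := (cob (b `|` u)).1 (T (b `|` u)).
have Su' e : S e -> e <= b `|` u by move=> /Su eu; apply: lexUr.
have m'S e : S e -> e <= ideal_val m'.
  by move=> Se; have := m'ub (PrincipalIdeal (Su' _ Se)) Se; rewrite -Order.le_val.
have ub_m' c (cbu : c <= b `|` u) : ubound S c -> ideal_val m' <= c.
  move=> Sc; have := m'lub (PrincipalIdeal cbu); rewrite -Order.le_val.
  by apply=> e /Sc; rewrite -Order.le_val.
have m'b : ideal_val m' <= b by apply: ub_m' => //; apply: leUl.
apply: (@le_trans _ _ (ideal_val m')); last by apply: ub_m' => //; apply: leUr.
have := mlub (PrincipalIdeal m'b); rewrite -Order.le_val.
by apply=> e /m'S; rewrite -Order.le_val.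
Qed.

Let inf_exists S : (S !=set0)%classic -> (infimums S !=set0)%classic.
Proof.
case=> s Ss; have /bounded_sup [m [mub mlub]] : ubound (lbound S) s.
  by move=> l /(_ _ Ss).
by exists m; split=> // e Se; apply: mlub => l; apply.
Qed.

Let ideal_distr b a (I : Type) (x : I -> D) (m w : D) :
  a <= b -> w <= b -> (forall i, x i <= b) ->
  infimums (range x) m -> m <= b -> (forall i, w <= a `|` x i) -> w <= a `|` m.
Proof.
move=> ab wb xb [mlb mglb] mb wax.
have := (cob b).2 (PrincipalIdeal ab) I (fun i => PrincipalIdeal (xb i))
  (PrincipalIdeal mb).
case=> [|_ /(_ (PrincipalIdeal wb))].
  split=> [_ [i _ <-]|[l lb] ll].
    by rewrite -Order.le_val /=; apply: mlb; exists i.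
  rewrite -Order.le_val /=; apply: mglb => _ [i _ <-].
  by have := ll (PrincipalIdeal (xb i)); rewrite -Order.le_val; apply; exists i.
rewrite -Order.le_val; apply=> _ [i _ <-].
by rewrite -Order.le_val; apply: wax.
Qed.

(** The members of [S] need not have a common bound, so each is replaced by its meet with b = a \/ s
    for one fixed [s] in [S]. These meets lie in one principal ideal, where distributivity applies;
    the case of two elements shows that [w] stays below the join of [a] with each of them. *)
Lemma meet_continuous_of : meet_continuous.
Proof.
have binary a x y m w : infimums [set x; y]%classic m ->
    w <= a `|` x -> w <= a `|` y -> w <= a `|` m.
  move=> minf wx wy; have mx : m <= x by apply: minf.1; left.
  apply: (@ideal_distr (a `|` x `|` y) a bool (fun c => if c then x else y)).
  - by join_le.
  - by apply: le_trans wx _; join_le.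
  - by case; join_le.
  - suff -> : range (fun c : bool => if c then x else y) = [set x; y]%classic by [].
    apply/seteqP; split=> [_ [[] _ <-]|_ [->|->]]; [by left|by right| |].
      by exists true.
    by exists false.
  - by apply: le_trans mx _; join_le.
  - by case.
move=> S S0; have [m [mlb mglb]] := inf_exists S0.
exists m; split=> // a w wS; case: (S0) => s Ss; set b := a `|` s.
have /choice [y yP] (e : {e | S e}) : exists y, infimums [set sval e; b]%classic y.
  by apply: inf_exists; exists b; right.
have y_le e : y e <= sval e /\ y e <= b by split; apply: (yP e).1; [left|right].
have [] := @inf_exists (range y); first by exists (y (exist _ _ Ss)), (exist _ _ Ss).
move=> m' m'inf; have m'y e : m' <= y e by apply: m'inf.1; exists e.
have : w <= a `|` m'.
  apply: (@ideal_distr b a _ y) => //.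
  - exact: leUl.
  - exact: wS.
  - by move=> e; apply: (y_le e).2.
  - exact: le_trans (m'y (exist _ _ Ss)) (y_le _).2.
  - move=> e; apply: binary (yP e) _ _; first exact: wS (svalP e).
    by apply: le_trans (wS _ Ss) _; rewrite /b; join_le.
move/le_trans; apply; rewrite leUx leUl /=; apply: lexUr; apply: mglb => e Se.
exact: le_trans (m'y (exist _ _ Se)) (y_le _).1.
Qed.

End CoBrouwer.

(** * Lattices valued in a semilattice *)

(* [vle x y] is the degree to which [x <= y] fails; the underlying lattice is
   the quotient of [vcar] by [vle x y = vle y x = \bot]. *)
Record vlat dD (D : bJoinSemilatticeType dD) := Vlat {
  vcar :> Type;
  vle : vcar -> vcar -> D;
  vmeet : vcar -> vcar -> vcar;
  vjoin : vcar -> vcar -> vcar;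
  vle_refl : forall x, vle x x = \bot;
  vle_trans : forall y x z, vle x z <= vle x y `|` vle y z;
  vle_joinl : forall x y z, vle (vjoin x y) z = vle x z `|` vle y z;
  vle_meetr : forall x y z, vle x (vmeet y z) = vle x y `|` vle x z }.

Section VlatTheory.
Context {dD : Order.disp_t} {D : bJoinSemilatticeType dD} {X : vlat D}.
Implicit Types (x y z : X) (a b : D).

Lemma join_eq_bot a b : a `|` b = \bot -> a = \bot /\ b = \bot.
Proof. by move/eqP; rewrite join_eq0 => /andP[/eqP-> /eqP->]. Qed.

Lemma vle_ul x y : vle x (vjoin x y) = \bot.
Proof. by have /esym := vle_refl (vjoin x y); rewrite vle_joinl => /esym/join_eq_bot[]. Qed.

Lemma vle_ur x y : vle y (vjoin x y) = \bot.
Proof. by have /esym := vle_refl (vjoin x y); rewrite vle_joinl => /esym/join_eq_bot[]. Qed.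

Lemma vle_ml x y : vle (vmeet x y) x = \bot.
Proof. by have /esym := vle_refl (vmeet x y); rewrite vle_meetr => /esym/join_eq_bot[]. Qed.

Lemma vle_mr x y : vle (vmeet x y) y = \bot.
Proof. by have /esym := vle_refl (vmeet x y); rewrite vle_meetr => /esym/join_eq_bot[]. Qed.

Lemma vle_homol x y z : vle x y = \bot -> vle x z <= vle y z.
Proof. by move=> xy; apply: le_trans (vle_trans y x z) _; rewrite xy join0x. Qed.

Lemma vle_homor x y z : vle y z = \bot -> vle x z <= vle x y.
Proof. by move=> yz; apply: le_trans (vle_trans y x z) _; rewrite yz joinx0. Qed.

Definition veq x y := vle x y = \bot /\ vle y x = \bot.

Lemma vle_trans0 y x z : vle x y = \bot -> vle y z = \bot -> vle x z = \bot.
Proof. by move=> xy yz; apply/eqP; rewrite -lex0 -yz; apply: vle_homol. Qed.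

Lemma veq_vlel x y z : veq x y -> vle x z = vle y z.
Proof. by case=> xy yx; apply: le_anti; rewrite !vle_homol. Qed.

Lemma veq_vler x y z : veq x y -> vle z x = vle z y.
Proof. by case=> xy yx; apply: le_anti; rewrite !vle_homor. Qed.

Lemma veq_refl x : veq x x.
Proof. by split; rewrite vle_refl. Qed.

Lemma veq_sym x y : veq x y -> veq y x.
Proof. by case. Qed.

Lemma veq_trans x y z : veq x y -> veq y z -> veq x z.
Proof. by move=> [a b] [c d]; split; [apply: vle_trans0 a c|apply: vle_trans0 d b]. Qed.

Lemma veq_join x x' y y' : veq x x' -> veq y y' -> veq (vjoin x y) (vjoin x' y').
Proof.
move=> exx' eyy'; split; rewrite vle_joinl.
  by rewrite (veq_vlel _ exx') (veq_vlel _ eyy') vle_ul vle_ur joinxx.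
by rewrite -(veq_vlel _ exx') -(veq_vlel _ eyy') vle_ul vle_ur joinxx.
Qed.

Lemma veq_meet x x' y y' : veq x x' -> veq y y' -> veq (vmeet x y) (vmeet x' y').
Proof.
move=> exx' eyy'; split; rewrite vle_meetr.
  by rewrite -(veq_vler _ exx') -(veq_vler _ eyy') vle_ml vle_mr joinxx.
by rewrite (veq_vler _ exx') (veq_vler _ eyy') vle_ml vle_mr joinxx.
Qed.

Lemma eq_from_ub a b : (forall c, (a <= c) = (b <= c)) -> a = b.
Proof. by move=> ab; apply: le_anti; rewrite ab lexx -ab lexx. Qed.

End VlatTheory.

(** The map [h] changes the truth values and is [idfun] when they stay the same. Operations are
    preserved up to [veq] only, since carriers are not divided by it. *)
Record vhom dD (D : bJoinSemilatticeType dD) dE (E : bJoinSemilatticeType dE)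
    (h : D -> E) (X : vlat D) (Y : vlat E) (f : X -> Y) : Prop := Vhom {
  vhom_vle : forall x y, vle (f x) (f y) = h (vle x y);
  vhom_join : forall x y, veq (f (vjoin x y)) (vjoin (f x) (f y));
  vhom_meet : forall x y, veq (f (vmeet x y)) (vmeet (f x) (f y)) }.

(** * The valuation of a lattice by its principal congruences *)

Section CongruenceOrder.
Context {d : Order.disp_t} {K : latticeType d}.
Variables (theta : K -> K -> Prop) (ct : congruence theta).
Implicit Types x y z : K.

(** The order of the quotient by [theta], pulled back to [K]. *)
Definition leC x y := theta (x `&` y) x.

Lemma leC_joinE x y : leC x y <-> theta (x `|` y) y.
Proof.
split=> h.
  by have := congr_join ct (congr_sym ct h) (congr_refl ct y); rewrite (join_r (leIr _ _)).
by have := congr_meet ct (congr_refl ct x) (congr_sym ct h); rewrite joinKI.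
Qed.

Lemma leC_le x y : x <= y -> leC x y.
Proof. by move=> /meet_l; rewrite /leC => ->; apply: congr_refl. Qed.

Lemma leC_trans y x z : leC x y -> leC y z -> leC x z.
Proof.
rewrite /leC => xy yz; apply: (congr_trans ct _ xy).
apply: (congr_trans ct (y := x `&` (y `&` z))); last first.
  by apply: (congr_meet ct) => //; apply: congr_refl.
rewrite meetA; apply: (congr_meet ct); last exact: congr_refl.
exact: (congr_sym ct xy).
Qed.

Lemma leC_joinl x y z : leC (x `|` y) z <-> leC x z /\ leC y z.
Proof.
split=> [h|[/leC_joinE xz /leC_joinE yz]].
  by split; apply: leC_trans h; apply: leC_le; [apply: leUl|apply: leUr].
apply/leC_joinE; rewrite -joinA; apply: (congr_trans ct _ xz).
by apply: (congr_join ct) => //; apply: congr_refl.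
Qed.

Lemma leC_meetr x y z : leC x (y `&` z) <-> leC x y /\ leC x z.
Proof.
split=> [h|[xy xz]].
  by split; apply: leC_trans h _; apply: leC_le; [apply: leIl|apply: leIr].
rewrite /leC meetA; apply: (congr_trans ct _ xz).
by apply: (congr_meet ct) => //; apply: congr_refl.
Qed.

Lemma congrE x y : theta x y <-> leC x y /\ leC y x.
Proof.
split=> [xy|[xy yx]]; last first.
  by apply: (congr_trans ct (congr_sym ct xy) _); rewrite meetC.
split; rewrite /leC.
  by have := congr_meet ct (congr_refl ct x) (congr_sym ct xy); rewrite meetxx.
by have := congr_meet ct (congr_refl ct y) xy; rewrite meetxx.
Qed.

End CongruenceOrder.

Section PrincipalCongruence.
Context {d : Order.disp_t} {K : latticeType d}.
Implicit Types (x y z : K) (a b : conc K).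

Lemma conc_leP a b : reflect (forall x y, a x y -> b x y) (a <= b).
Proof. exact: asboolP. Qed.

Definition conc_seq (s : seq (K * K)) : conc K :=
  Conc (con_gen_congruence _) (ex_intro _ s erefl).

Lemma conc_seq_le s a : conc_seq s <= a <-> (forall x y, (x, y) \in s -> a x y).
Proof.
split=> [/conc_leP h x y xy|h]; first by apply: h; apply: con_gen_sub.
by apply/conc_leP; apply: con_gen_min => //; apply: conc_congruence.
Qed.

(** The least congruence that forces x <= y: the value of x <= y in Con_c K. *)
Definition cg x y := conc_seq [:: (x `&` y, x)].

Lemma cg_le x y a : cg x y <= a <-> leC a x y.
Proof.
rewrite conc_seq_le; split=> [|xy u v]; first by apply; rewrite mem_head.
by rewrite inE => /eqP[-> ->].
Qed.

Lemma bot_conc x y : (\bot : conc K) x y -> x = y.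
Proof.
apply: (con_gen_min (theta := eq)) => //.
by split=> // [x' y' z' -> ->|? ? ? ? -> ->|? ? ? ? -> ->].
Qed.

Lemma cg_eq0 x y : cg x y = \bot <-> x <= y.
Proof.
split=> [h|xy]; last first.
  apply/eqP; rewrite -lex0; apply/cg_le.
  by apply: leC_le => //; apply: conc_congruence.
have /cg_le/bot_conc <- : cg x y <= \bot by rewrite h.
exact: leIr.
Qed.

Lemma cg_refl x : cg x x = \bot.
Proof. exact/cg_eq0. Qed.

Lemma cg_trans y x z : cg x z <= cg x y `|` cg y z.
Proof.
apply/cg_le; apply: (leC_trans (conc_congruence _) (y := y)); apply/cg_le.
  exact: leUl.
exact: leUr.
Qed.

Lemma cg_joinl x y z : cg (x `|` y) z = cg x z `|` cg y z.
Proof.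
apply: eq_from_ub => a; apply/idP/idP; rewrite leUx.
  by move=> /cg_le/(leC_joinl (conc_congruence _))[? ?]; apply/andP; split; apply/cg_le.
by case/andP=> /cg_le ? /cg_le ?; apply/cg_le/(leC_joinl (conc_congruence _)).
Qed.

Lemma cg_meetr x y z : cg x (y `&` z) = cg x y `|` cg x z.
Proof.
apply: eq_from_ub => a; apply/idP/idP; rewrite leUx.
  by move=> /cg_le/(leC_meetr (conc_congruence _))[? ?]; apply/andP; split; apply/cg_le.
by case/andP=> /cg_le ? /cg_le ?; apply/cg_le/(leC_meetr (conc_congruence _)).
Qed.

Definition conc_vlat : vlat (conc K) :=
  Vlat cg_refl cg_trans cg_joinl cg_meetr.

End PrincipalCongruence.
Arguments conc_vlat {d} K.

Section ConcMapTheory.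
Context {d d' : Order.disp_t} {K : latticeType d} {L : latticeType d'}.
Variable f : {lmorphism K -> L}.
Implicit Types (a b : conc K) (c : conc L).

Lemma conc_map_le a c :
  conc_map f a <= c <-> (forall x y, a x y -> c (f x) (f y)).
Proof.
split=> [/conc_leP h x y xy|h].
  by apply: h; apply: con_gen_sub; exists x, y.
apply/conc_leP; apply: con_gen_min => [|_ _ [x [y [xy -> ->]]]].
  exact: conc_congruence.
exact: h.
Qed.

Lemma conc_map_congr a x y : a x y -> conc_map f a (f x) (f y).
Proof. by move: x y; apply/conc_map_le. Qed.

Lemma preimage_congruence (theta : L -> L -> Prop) : congruence theta ->
  congruence (fun x y => theta (f x) (f y)).
Proof.
move=> ct; split=> [x|x y|x y z|x x' y y'|x x' y y'].
- exact: congr_refl.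
- exact: congr_sym.
- exact: congr_trans.
- by rewrite !omorphI; apply: congr_meet.
- by rewrite !omorphU; apply: congr_join.
Qed.

Lemma conc_map_gen_le s c :
  conc_map f (conc_seq s) <= c <-> (forall x y, (x, y) \in s -> c (f x) (f y)).
Proof.
split=> [/conc_map_le h x y xys|h]; first by apply: h; apply: con_gen_sub.
apply/conc_map_le; apply: con_gen_min h.
exact: preimage_congruence (conc_congruence c).
Qed.

Lemma conc_map_cg x y : conc_map f (cg x y) = cg (f x) (f y).
Proof.
apply: eq_from_ub => c; apply/idP/idP.
  move/conc_map_gen_le => h; apply/cg_le; rewrite /leC -omorphI.
  by apply: h; rewrite mem_head.
move/cg_le; rewrite /leC -omorphI => h; apply/conc_map_gen_le => u v.
by rewrite inE => /eqP[-> ->].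
Qed.

Lemma conc_map_join : {morph conc_map f : a b / a `|` b}.
Proof.
move=> a b; apply: eq_from_ub => c; apply/idP/idP; rewrite leUx.
  move/conc_map_le => h; apply/andP; split; apply/conc_map_le => x y xy;
    by apply: h; apply: con_gen_sub => /=; auto.
case/andP=> /conc_map_le ha /conc_map_le hb; apply/conc_map_le.
apply: con_gen_min; first exact: preimage_congruence (conc_congruence c).
by move=> x y [/ha|/hb].
Qed.

Lemma conc_map0 : conc_map f \bot = \bot.
Proof.
apply/eqP; rewrite -lex0; apply/conc_map_le => x y /bot_conc ->.
exact: congr_refl (conc_congruence _) _.
Qed.

Lemma conc_map_eq0 a : injective f -> conc_map f a = \bot -> a = \bot.
Proof.
move=> injf a0; apply/eqP; rewrite -lex0; apply/conc_leP => x y xy.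
have := conc_map_congr xy; rewrite a0 => /bot_conc/injf ->.
exact: congr_refl (conc_congruence _) _.
Qed.

End ConcMapTheory.
Arguments meet_continuous {dD} D.

(** * Completion of partial valued lattices by bounded ideals *)

Section Dinf.
Context {dD : Order.disp_t} {D : bJoinSemilatticeType dD}.
Hypothesis mc : meet_continuous D.
Implicit Types (a b w : D) (S : set D).

(** For nonempty [S] the hypothesis [mc] supplies such an element, so the default [\bot] is not
    taken. *)
Definition dinf S : D := xget \bot (fun m => lbound S m /\
  forall a w, (forall s, S s -> w <= a `|` s) -> w <= a `|` m).

Lemma dinf_lb S s : S s -> dinf S <= s.
Proof.
move=> Ss; rewrite /dinf; case: xgetP => [m _ [mlb _]|]; first exact: mlb.
by case: (mc (ex_intro _ s Ss)) => m mS /(_ m).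
Qed.

Lemma dinf_glb S a w : (S !=set0)%classic ->
  (forall s, S s -> w <= a `|` s) -> w <= a `|` dinf S.
Proof.
move=> /mc[m mS]; rewrite /dinf; case: xgetP => [m' _ [_]|]; first exact.
by move=> /(_ m).
Qed.

Lemma dinf_glb0 S w : (S !=set0)%classic ->
  (forall s, S s -> w <= s) -> w <= dinf S.
Proof.
move=> S0 wS; rewrite -[dinf S]join0x; apply: dinf_glb => // s /wS.
by rewrite join0x.
Qed.

End Dinf.

Section Completion.
Context {dD : Order.disp_t} {D : bJoinSemilatticeType dD}.
Hypothesis mc : meet_continuous D.
(** A partial lattice: [J a b c] declares c = a \/ b and [M a b c] declares c = a /\ b. The elements
    of [B] serve as bounds for all others. *)
Variables (P : Type) (v : P -> P -> D) (J M : P -> P -> P -> Prop).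
Hypothesis v_refl : forall x, v x x = \bot.
Hypothesis v_trans : forall y x z, v x z <= v x y `|` v y z.
Hypothesis J_sup : forall a b c, J a b c -> forall x, v c x = v a x `|` v b x.
Hypothesis M_inf : forall a b c, M a b c -> forall x, v x c = v x a `|` v x b.
Variables (B : vlat D) (k : B -> P).
Hypothesis k_vle : forall a b, v (k a) (k b) = vle a b.
Hypothesis k_bound : forall p, exists a b, v (k a) p = \bot /\ v p (k b) = \bot.

(* [I x] is the degree to which [x] fails to belong to the ideal [I]: the
   pointwise order on such maps is reverse inclusion. *)
Definition ideal (I : P -> D) :=
  (forall x y, I x <= v x y `|` I y) /\
  (forall a b c, J a b c -> I c <= I a `|` I b).

(** As degrees reverse inclusion, the bounds say that the ideal contains [k a] and lies below
    [k b]. *)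
Record bideal := Bideal {
  bideal_fun :> P -> D;
  bidealP : ideal bideal_fun;
  bideal_bound : exists a b,
    (forall x, bideal_fun x <= v x (k a)) /\ (forall x, v x (k b) <= bideal_fun x) }.

Implicit Types (I H : bideal).

Let principal_ideal p : ideal (v ^~ p).
Proof.
split=> [x y|a b c Jabc]; first exact: v_trans.
by rewrite (J_sup Jabc).
Qed.

Let principal_bound p : exists a b,
  (forall x, v x p <= v x (k a)) /\ (forall x, v x (k b) <= v x p).
Proof.
have [b [a [bp pa]]] := k_bound p; exists b, a.
by split=> x; [rewrite (le_trans (v_trans (k b) _ _)) ?bp ?joinx0
              |rewrite (le_trans (v_trans p _ _)) ?pa ?joinx0].
Qed.

Definition principal p : bideal := Bideal (principal_ideal p) (principal_bound p).

Let meet_ideal (I H : bideal) : ideal (fun x => I x `|` H x).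
Proof.
split=> [x y|a b c Jabc]; rewrite leUx.
  by rewrite (le_trans ((bidealP I).1 x y)) ?(le_trans ((bidealP H).1 x y)) //; join_le.
by rewrite (le_trans ((bidealP I).2 _ _ _ Jabc)) ?(le_trans ((bidealP H).2 _ _ _ Jabc)) //;
  join_le.
Qed.

Let v_homol x y z : v x y = \bot -> v x z <= v y z.
Proof. by move=> xy; apply: le_trans (v_trans y x z) _; rewrite xy join0x. Qed.

Let v_homor x y z : v y z = \bot -> v x z <= v x y.
Proof. by move=> yz; apply: le_trans (v_trans y x z) _; rewrite yz joinx0. Qed.

Let meet_bound (I H : bideal) : exists a b,
  (forall x, I x `|` H x <= v x (k a)) /\ (forall x, v x (k b) <= I x `|` H x).
Proof.
have [a [b [Ia bI]]] := bideal_bound I; have [a' [b' [Ha' bH]]] := bideal_bound H.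
exists (vmeet a a'), b; split=> x; last exact: lexUl.
rewrite leUx (le_trans (Ia x)) ?(le_trans (Ha' x)) //; apply: v_homor;
  by rewrite k_vle ?vle_ml ?vle_mr.
Qed.

Definition bideal_meet I H : bideal := Bideal (meet_ideal I H) (meet_bound I H).

(** The intersection of all ideals containing [I] and [H], that is, the pointwise supremum of their
    degrees. It is computed as the infimum of the upper bounds, one of which is [I x]. *)
Let joinfun (I H : bideal) x : D := dinf (fun u =>
  forall G, ideal G -> (forall y, G y <= I y) -> (forall y, G y <= H y) -> G x <= u).

Let joinfun_le I H x u : joinfun I H x <= u <->
  forall G, ideal G -> (forall y, G y <= I y) -> (forall y, G y <= H y) -> G x <= u.
Proof.
split=> [h G idG GI GH|]; last by move=> h; apply: dinf_lb.
apply: le_trans h; apply: dinf_glb0 => //.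
  by exists (I x) => G' _ G'I _; apply: G'I.
by move=> s; apply.
Qed.

Let joinfun_ub I H G x : ideal G -> (forall y, G y <= I y) ->
  (forall y, G y <= H y) -> G x <= joinfun I H x.
Proof. by move=> idG GI GH; apply: (joinfun_le I H x _).1. Qed.

Let join_ideal I H : ideal (joinfun I H).
Proof.
split=> [x y|a b c Jabc]; apply/joinfun_le => G idG GI GH.
  apply: le_trans (idG.1 x y) _; rewrite leUx leUl /=; apply: lexUr.
  exact: joinfun_ub.
apply: le_trans (idG.2 _ _ _ Jabc) _.
by rewrite leUx; apply/andP; split; [apply: lexUl|apply: lexUr]; apply: joinfun_ub.
Qed.

Let joinfun_l I H x : joinfun I H x <= I x.
Proof. by apply/joinfun_le => G _ GI _; apply: GI. Qed.

Let joinfun_r I H x : joinfun I H x <= H x.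
Proof. by apply/joinfun_le => G _ _ GH; apply: GH. Qed.

Let join_bound (I H : bideal) : exists a b,
  (forall x, joinfun I H x <= v x (k a)) /\ (forall x, v x (k b) <= joinfun I H x).
Proof.
have [a [b [Ia bI]]] := bideal_bound I; have [a' [b' [Ha' bH]]] := bideal_bound H.
exists a, (vjoin b b'); split=> x; first exact: le_trans (joinfun_l _ _ _) (Ia x).
apply: (@joinfun_ub _ _ (v ^~ (k (vjoin b b')))) => // y.
  by apply: le_trans (bI y); apply: v_homor; rewrite k_vle vle_ul.
by apply: le_trans (bH y); apply: v_homor; rewrite k_vle vle_ur.
Qed.

Definition bideal_join I H : bideal := Bideal (join_ideal I H) (join_bound I H).

(** The truth value of the inclusion of [I] in [H]: the implication from [I x] to [H x], quantified
    over all [x], in the dual of a Heyting algebra. *)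
Definition bideal_vle (I H : bideal) : D :=
  dinf (fun u => forall x, H x <= u `|` I x).

Let bideal_vle_ne (I H : bideal) : exists u, forall x, H x <= u `|` I x.
Proof.
have [a [b [Ia bI]]] := bideal_bound I; have [a' [b' [Ha' bH]]] := bideal_bound H.
(* Forcing the upper bound of [I] below the lower bound of [H] forces [I] into [H]. *)
exists (v (k b) (k a')) => x; apply: le_trans (Ha' x) _.
apply: le_trans (v_trans (k b) _ _) _; rewrite joinC.
by rewrite leUx leUl lexUr.
Qed.

Lemma bideal_vle_le I H u : bideal_vle I H <= u <-> forall x, H x <= u `|` I x.
Proof.
split=> [h x|]; last by move=> h; apply: dinf_lb.
apply: (@le_trans _ _ (bideal_vle I H `|` I x)); last by rewrite leU2.
rewrite joinC; apply: dinf_glb => // s /(_ x); by rewrite joinC.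
Qed.

Let bideal_vleP I H x : H x <= bideal_vle I H `|` I x.
Proof. by move: x; apply/bideal_vle_le. Qed.

Fact bideal_vle_refl I : bideal_vle I I = \bot.
Proof. by apply/eqP; rewrite -lex0; apply/bideal_vle_le => x; apply: leUr. Qed.

Fact bideal_vle_trans H I (G : bideal) : bideal_vle I G <= bideal_vle I H `|` bideal_vle H G.
Proof.
apply/bideal_vle_le => x; apply: le_trans (bideal_vleP H G x) _.
rewrite leUx; apply/andP; split; first by join_le.
by apply: le_trans (bideal_vleP I H x) _; join_le.
Qed.

(* The greatest [G'] with [G <= e \/ G'], a difference in the co-Brouwerian
   sense, is an ideal whenever [G] is. *)
Let diff (e : D) (G : bideal) x : D := dinf (fun u => G x <= e `|` u).

Let diffP e (G : bideal) x : G x <= e `|` diff e G x.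
Proof. by apply: dinf_glb => //; exists (G x); apply: leUr. Qed.

Let diff_le e (G : bideal) x u : G x <= e `|` u -> diff e G x <= u.
Proof. by move=> h; apply: dinf_lb. Qed.

Let diff_ideal e (G : bideal) : ideal (diff e G).
Proof.
split=> [x y|a b c Jabc]; apply: diff_le.
  apply: le_trans ((bidealP G).1 x y) _; rewrite leUx lexUr ?leUl //=.
  by apply: le_trans (diffP e G y) _; join_le.
apply: le_trans ((bidealP G).2 _ _ _ Jabc) _; rewrite leUx.
by rewrite (le_trans (diffP e G a)) ?(le_trans (diffP e G b)) //; join_le.
Qed.

Fact bideal_vle_joinl I H (G : bideal) :
  bideal_vle (bideal_join I H) G = bideal_vle I G `|` bideal_vle H G.
Proof.
apply: le_anti; apply/andP; split; last first.
  rewrite leUx; apply/andP; split; apply/bideal_vle_le => x;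
    apply: le_trans (bideal_vleP (bideal_join I H) G x) _;
    rewrite leUx leUl lexUr //=; first [exact: joinfun_l|exact: joinfun_r].
set e := _ `|` _; apply/bideal_vle_le => x.
apply: le_trans (diffP e G x) _; rewrite leUx leUl lexUr //=.
(* By the choice of [e], the ideal [diff e G] contains [I] and [H], hence also their join. *)
apply: joinfun_ub; first exact: diff_ideal.
  move=> y; apply: diff_le; apply: le_trans (bideal_vleP I G y) _.
  by rewrite /e; join_le.
move=> y; apply: diff_le; apply: le_trans (bideal_vleP H G y) _.
by rewrite /e; join_le.
Qed.

Fact bideal_vle_meetr (G I H : bideal) :
  bideal_vle G (bideal_meet I H) = bideal_vle G I `|` bideal_vle G H.
Proof.
apply: le_anti; apply/andP; split; last first.
  rewrite leUx; apply/andP; split; apply/bideal_vle_le => x;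
    have := bideal_vleP G (bideal_meet I H) x; rewrite /= leUx => /andP[? ?] //.
apply/bideal_vle_le => x /=; rewrite leUx.
by rewrite (le_trans (bideal_vleP G I x)) ?(le_trans (bideal_vleP G H x)) //; join_le.
Qed.

Definition bideal_vlat : vlat D := Vlat bideal_vle_refl bideal_vle_trans
  bideal_vle_joinl bideal_vle_meetr.

Let principal_vle p q : bideal_vle (principal p) (principal q) = v p q.
Proof.
apply: le_anti; apply/andP; split.
  by apply/bideal_vle_le => x /=; rewrite joinC.
by have := bideal_vleP (principal p) (principal q) p; rewrite /= v_refl joinx0.
Qed.

(** The embedding takes principal ideals. It respects [J] because ideals are closed under the
    declared joins, and [M] because [M_inf] makes the principal ideal of a declared meet the
    intersection of the two principal ideals. *)
Lemma completion : exists (X : vlat D) (i : P -> X),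
  [/\ forall p q, vle (i p) (i q) = v p q,
      forall a b c, J a b c -> veq (i c) (vjoin (i a) (i b)),
      forall a b c, M a b c -> veq (i c) (vmeet (i a) (i b)) &
      forall x, exists a b, vle (i (k a)) x = \bot /\ vle x (i (k b)) = \bot].
Proof.
exists bideal_vlat, principal; split=> [||a b c Mabc|x].
- exact: principal_vle.
- move=> a b c Jabc; split; last first.
    by rewrite vle_joinl /= !principal_vle -(J_sup Jabc) v_refl.
  apply/eqP; rewrite -lex0; apply/bideal_vle_le => x /=; rewrite join0x.
  apply/joinfun_le => G idG Ga Gb; apply: le_trans (idG.1 x c) _.
  rewrite leUx lexx /=; apply: le_trans (idG.2 _ _ _ Jabc) _.
  by rewrite leUx (le_trans (Ga a)) /= ?(le_trans (Gb b)) //= v_refl le0x.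
- split; first by rewrite vle_meetr /= !principal_vle -(M_inf Mabc) v_refl.
  apply/eqP; rewrite -lex0; apply/bideal_vle_le => x /=.
  by rewrite join0x (M_inf Mabc).
have [a [b [Ia bI]]] := bideal_bound x; exists a, b; split.
  by apply/eqP; rewrite -lex0; apply/bideal_vle_le => y; rewrite join0x Ia.
by apply/eqP; rewrite -lex0; apply/bideal_vle_le => y; rewrite join0x bI.
Qed.

End Completion.

(** * Homomorphisms and amalgamation *)

Section VhomTheory.
Context {dD : Order.disp_t} {D : bJoinSemilatticeType dD}.
Context {dE : Order.disp_t} {E : bJoinSemilatticeType dE}.
Variables (h : D -> E) (X : vlat D) (Y : vlat E) (f : X -> Y).
Hypothesis hf : vhom h f.

Lemma vhom_joinl x y z :
  vle (f (vjoin x y)) z = vle (f x) z `|` vle (f y) z.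
Proof. by rewrite (veq_vlel _ (vhom_join hf x y)) vle_joinl. Qed.

Lemma vhom_meetr x y z :
  vle z (f (vmeet x y)) = vle z (f x) `|` vle z (f y).
Proof. by rewrite (veq_vler _ (vhom_meet hf x y)) vle_meetr. Qed.

Lemma vhom_veq x y : h \bot = \bot -> veq x y -> veq (f x) (f y).
Proof. by move=> h0 [xy yx]; split; rewrite (vhom_vle hf) ?xy ?yx. Qed.

End VhomTheory.

Lemma vhom_comp dD (D : bJoinSemilatticeType dD) dE (E : bJoinSemilatticeType dE)
    dF (F : bJoinSemilatticeType dF) (h : D -> E) (h' : E -> F)
    (X : vlat D) (Y : vlat E) (Z : vlat F) (f : X -> Y) (g : Y -> Z) :
  h' \bot = \bot -> vhom h f -> vhom h' g -> vhom (h' \o h) (g \o f).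
Proof.
move=> h'0 hf hg; split=> [x y|x y|x y] /=.
- by rewrite (vhom_vle hg) (vhom_vle hf).
- apply: veq_trans _ (vhom_join hg _ _); apply: (vhom_veq hg h'0).
  exact: vhom_join hf _ _.
- apply: veq_trans _ (vhom_meet hg _ _); apply: (vhom_veq hg h'0).
  exact: vhom_meet hf _ _.
Qed.

Section Cross.
Context {dD : Order.disp_t} {D : bJoinSemilatticeType dD}.
Hypothesis mc : meet_continuous D.
Variables (A X B : vlat D) (jX : A -> X) (jB : A -> B) (a0 : A).
Hypotheses (hX : vhom idfun jX) (hB : vhom idfun jB).
Implicit Types (x y z : X) (b c : B).

(** The value of x <= b across the two lattices: some [a] in the common part satisfies x <= a <= b,
    the existential quantifier being an infimum in [D]. *)
Definition cross x b : D :=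
  dinf (fun u => exists a, u = vle x (jX a) `|` vle (jB a) b).

Lemma cross_lb x b a : cross x b <= vle x (jX a) `|` vle (jB a) b.
Proof. by apply: dinf_lb => //; exists a. Qed.

Lemma cross_glb x b e w : (forall a, w <= e `|` (vle x (jX a) `|` vle (jB a) b)) ->
  w <= e `|` cross x b.
Proof.
move=> h; apply: dinf_glb => // [|_ [a ->] //].
by exists (vle x (jX a0) `|` vle (jB a0) b), a0.
Qed.

Lemma cross_transl y x b : cross x b <= vle x y `|` cross y b.
Proof.
apply: cross_glb => a; apply: le_trans (cross_lb x b a) _; rewrite joinA.
by rewrite leU2 //; apply: vle_trans.
Qed.

Lemma cross_transr c x b : cross x b <= cross x c `|` vle c b.
Proof.
rewrite joinC; apply: cross_glb => a; apply: le_trans (cross_lb x b a) _.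
rewrite leUx; apply/andP; split; first by join_le.
by apply: le_trans (vle_trans c _ _) _; join_le.
Qed.

(** From x <= a <= b and y <= a' <= b follows x \/ y <= a \/ a' <= b. Meet continuity allows the two
    infima to be opened one after the other. *)
Lemma cross_joinl x y b : cross (vjoin x y) b = cross x b `|` cross y b.
Proof.
apply: le_anti; apply/andP; split; last first.
  rewrite leUx; apply/andP; split;
    by apply: le_trans (cross_transl (vjoin x y) _ _) _;
       rewrite ?vle_ul ?vle_ur join0x.
apply: cross_glb => a'; rewrite joinC; apply: cross_glb => a.
apply: le_trans (cross_lb _ _ (vjoin a a')) _.
rewrite vle_joinl (vhom_joinl hB) !leUx; apply/andP; split; apply/andP; split.
- apply: le_trans (vle_homor _ (y := jX a) _) _; last by join_le.
  by rewrite (vhom_vle hX) vle_ul.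
- apply: le_trans (vle_homor _ (y := jX a') _) _; last by join_le.
  by rewrite (vhom_vle hX) vle_ur.
- by join_le.
- by join_le.
Qed.

Lemma cross_meetr x b c : cross x (vmeet b c) = cross x b `|` cross x c.
Proof.
apply: le_anti; apply/andP; split; last first.
  rewrite leUx; apply/andP; split;
    by apply: le_trans (cross_transr (vmeet b c) _ _) _;
       rewrite ?vle_ml ?vle_mr joinx0.
apply: cross_glb => a'; rewrite joinC; apply: cross_glb => a.
apply: le_trans (cross_lb _ _ (vmeet a a')) _.
rewrite vle_meetr (vhom_meetr hX) !leUx; apply/andP; split; apply/andP; split.
- by join_le.
- by join_le.
- apply: le_trans (vle_homol _ (y := jB a) _) _; last by join_le.
  by rewrite (vhom_vle hB) vle_ml.
- apply: le_trans (vle_homol _ (y := jB a') _) _; last by join_le.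
  by rewrite (vhom_vle hB) vle_mr.
Qed.

Lemma cross_l x a : cross x (jB a) = vle x (jX a).
Proof.
apply: le_anti; apply/andP; split.
  by apply: le_trans (cross_lb x _ a) _; rewrite vle_refl joinx0.
rewrite -[leRHS]join0x; apply: cross_glb => a'; rewrite join0x.
by rewrite (vhom_vle hB) /= -[vle a' a](vhom_vle hX); apply: vle_trans.
Qed.

Lemma cross_r a b : cross (jX a) b = vle (jB a) b.
Proof.
apply: le_anti; apply/andP; split.
  by apply: le_trans (cross_lb _ b a) _; rewrite vle_refl join0x.
rewrite -[leRHS]join0x; apply: cross_glb => a'; rewrite join0x.
by rewrite (vhom_vle hX) /= -[vle a a'](vhom_vle hB); apply: vle_trans.
Qed.

End Cross.

Section CrossCross.
Context {dD : Order.disp_t} {D : bJoinSemilatticeType dD}.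
Hypothesis mc : meet_continuous D.
Variables (A X B : vlat D) (jX : A -> X) (jB : A -> B) (a0 : A).
Hypotheses (hX : vhom idfun jX) (hB : vhom idfun jB).

(** Given x <= a <= b <= a' <= y, the step from [a] to [a'] is made in [B], but it has the same
    value in [A] and hence in [X]. This is why amalgamation leaves the values on [X] unchanged. *)
Lemma cross_cross b x y :
  vle x y <= cross jX jB x b `|` cross jB jX b y.
Proof.
apply: cross_glb => // a'; rewrite joinC; apply: cross_glb => // a.
apply: le_trans (vle_trans (jX a') x y) _; rewrite leUx.
apply/andP; split; last by join_le.
apply: le_trans (vle_trans (jX a) x _) _; rewrite leUx.
apply/andP; split; first by join_le.
rewrite (vhom_vle hX) /= -[vle a a'](vhom_vle hB).
by apply: le_trans (vle_trans b _ _) _; join_le.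
Qed.

End CrossCross.

Section Amalgam.
Context {dD : Order.disp_t} {D : bJoinSemilatticeType dD}.
Hypothesis mc : meet_continuous D.
Variables (A X B : vlat D) (jX : A -> X) (jB : A -> B) (a0 : A).
Hypotheses (hX : vhom idfun jX) (hB : vhom idfun jB).
Hypothesis X_bound : forall x, exists a a',
  vle (jX a) x = \bot /\ vle x (jX a') = \bot.

Let P := (X + B)%type.

Let v (p q : P) : D :=
  match p, q with
  | inl x, inl y => vle x y
  | inl x, inr b => cross jX jB x b
  | inr b, inl x => cross jB jX b x
  | inr b, inr c => vle b c
  end.

Let v_refl p : v p p = \bot.
Proof. by case: p => x; apply: vle_refl. Qed.

Let v_trans q p r : v p r <= v p q `|` v q r.
Proof.
case: p q r => [x|x] [y|y] [z|z] /=; first [exact: vle_trans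
  | exact: cross_transl | exact: cross_transr | exact: cross_cross].
Qed.

Variant sum_join : P -> P -> P -> Prop :=
  | SumJoinl x y : sum_join (inl x) (inl y) (inl (vjoin x y))
  | SumJoinr b c : sum_join (inr b) (inr c) (inr (vjoin b c)).

Variant sum_meet : P -> P -> P -> Prop :=
  | SumMeetl x y : sum_meet (inl x) (inl y) (inl (vmeet x y))
  | SumMeetr b c : sum_meet (inr b) (inr c) (inr (vmeet b c)).

(** The disjoint union valued by [cross] is completed. The two copies of [a] become equal because
    [cross] between them reduces to [vle] of an element with itself. *)
Lemma amalgam : exists (Y : vlat D) (gX : X -> Y) (gB : B -> Y),
  [/\ vhom idfun gX, vhom idfun gB, forall a, veq (gX (jX a)) (gB (jB a)) &
      forall y, exists b b', vle (gB b) y = \bot /\ vle y (gB b') = \bot].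
Proof.
have [|||p|Y [i [iv iJ iM ibd]]] :=
  @completion _ _ mc P v sum_join sum_meet v_refl v_trans _ _ B inr.
- by move=> _ _ _ [x y|b c] [z|z] /=; rewrite ?vle_joinl ?cross_joinl.
- by move=> _ _ _ [x y|b c] [z|z] /=; rewrite ?vle_meetr ?cross_meetr.
- by [].
- case: p => [x|b] /=; last by exists b, b; rewrite vle_refl.
  have [a [a' [ax xa']]] := X_bound x; exists (jB a), (jB a').
  by rewrite (cross_r mc a0 hB hX) (cross_l mc a0 hX hB).
exists Y, (i \o inl), (i \o inr); split=> //.
- by split=> x y /=; [rewrite iv|apply: iJ; constructor|apply: iM; constructor].
- by split=> x y /=; [rewrite iv|apply: iJ; constructor|apply: iM; constructor].
- move=> a; split; rewrite /= iv /=.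
  by rewrite (cross_l mc a0 hX hB) vle_refl.
by rewrite (cross_r mc a0 hB hX) vle_refl.
Qed.

End Amalgam.

(** * Adjoining elements with prescribed join and meet *)

Section Adjunction.
Context {dD : Order.disp_t} {D : bJoinSemilatticeType dD}.
Hypothesis mc : meet_continuous D.

Let dmeet (a b : D) : D := dinf (fun u => u = a \/ u = b).

Let dmeet_l a b : dmeet a b <= a.
Proof. by apply: dinf_lb => //; left. Qed.

Let dmeet_r a b : dmeet a b <= b.
Proof. by apply: dinf_lb => //; right. Qed.

Let dmeet_glb (w e a b : D) : w <= e `|` a -> w <= e `|` b -> w <= e `|` dmeet a b.
Proof.
by move=> wa wb; apply: dinf_glb => // [|_ [->|->] //]; exists a; left.
Qed.

Let dmeet_glbl (w e a b : D) : w <= a `|` e -> w <= b `|` e -> w <= dmeet a b `|` e.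
Proof. by rewrite ![_ `|` e]joinC; apply: dmeet_glb. Qed.

(** The last two conditions are necessary. Where s <= o holds, n = n \/ s = j lies above t, so t = n
    /\ t = o; where j <= t holds, n = n /\ t = o lies below s, so j = n \/ s = s. *)
Record adjoinable (X : vlat D) (o s t j : X) : Prop := Adjoinable {
  adj_os : vle o s = \bot;
  adj_ot : vle o t = \bot;
  adj_sj : vle s j = \bot;
  adj_tj : vle t j = \bot;
  adj_lower : vle t o <= vle s o;
  adj_upper : vle j s <= vle j t }.

Variables (X : vlat D).

Record newpt := Newpt {
  pt_o : X; pt_s : X; pt_t : X; pt_j : X;
  ptP : adjoinable pt_o pt_s pt_t pt_j }.

(* A new element [n] with [n \/ s = j] and [n /\ t = o] lies below [z] iff
   [j <= z], or [s = j] and [o <= z]; dually for [z <= n]. *)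
Let U n z := dmeet (vle (pt_j n) z) (vle (pt_j n) (pt_s n) `|` vle (pt_o n) z).
Let L n z := dmeet (vle z (pt_o n)) (vle (pt_s n) (pt_o n) `|` vle z (pt_j n)).

Implicit Types (n : newpt) (w z : X).

Let vle_oj n : vle (pt_o n) (pt_j n) = \bot.
Proof. exact: vle_trans0 (adj_os (ptP n)) (adj_sj (ptP n)). Qed.

Let U_trans n z w : U n w <= U n z `|` vle z w.
Proof.
apply: dmeet_glbl; first by apply: le_trans (dmeet_l _ _) _; apply: vle_trans.
apply: le_trans (dmeet_r _ _) _; rewrite -joinA leU2 //; exact: vle_trans.
Qed.

Let L_trans n z w : L n z <= vle z w `|` L n w.
Proof.
apply: dmeet_glb; first by apply: le_trans (dmeet_l _ _) _; apply: vle_trans.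
apply: le_trans (dmeet_r _ _) _; rewrite joinCA leU2 //; exact: vle_trans.
Qed.

(** When the two factors use different alternatives, the second one serves for the meet, because o
    <= j makes j <= z imply o <= z. *)
Let U_meet n z w : U n (vmeet z w) <= U n z `|` U n w.
Proof.
have oj y : vle (pt_o n) y <= vle (pt_j n) y by apply: vle_homol.
have step a b : vle (pt_o n) z <= a -> vle (pt_o n) w <= b ->
    vle (pt_j n) (pt_s n) <= a `|` b -> U n (vmeet z w) <= a `|` b.
  move=> ha hb hjs; apply: le_trans (dmeet_r _ _) _; rewrite vle_meetr.
  by rewrite leUx hjs leU2.
apply: dmeet_glb; apply: dmeet_glbl.
- by apply: le_trans (dmeet_l _ _) _; rewrite vle_meetr.
- by apply: step => //; join_le.
- by apply: step => //; join_le.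
- by apply: step; join_le.
Qed.

Let L_join n z w : L n (vjoin z w) <= L n z `|` L n w.
Proof.
have oj y : vle y (pt_j n) <= vle y (pt_o n) by apply: vle_homor.
have step a b : vle z (pt_j n) <= a -> vle w (pt_j n) <= b ->
    vle (pt_s n) (pt_o n) <= a `|` b -> L n (vjoin z w) <= a `|` b.
  move=> ha hb hjs; apply: le_trans (dmeet_r _ _) _; rewrite vle_joinl.
  by rewrite leUx hjs leU2.
apply: dmeet_glb; apply: dmeet_glbl.
- by apply: le_trans (dmeet_l _ _) _; rewrite vle_joinl.
- by apply: step => //; join_le.
- by apply: step => //; join_le.
- by apply: step; join_le.
Qed.

(** There are four combinations of alternatives. When both are the second, the chain is z <= j <= s
    <= o <= w. *)
Let LU n z w : vle z w <= L n z `|` U n w.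
Proof.
have oj y : vle (pt_o n) y <= vle (pt_j n) y by apply: vle_homol.
have jo y : vle y (pt_j n) <= vle y (pt_o n) by apply: vle_homor.
apply: dmeet_glb; apply: dmeet_glbl.
- by apply: le_trans (vle_trans (pt_o n) _ _) _; rewrite leU2.
- by apply: le_trans (vle_trans (pt_j n) _ _) _; join_le.
- by apply: le_trans (vle_trans (pt_o n) _ _) _; join_le.
apply: le_trans (vle_trans (pt_j n) _ _) _; rewrite leUx; apply/andP; split.
  by join_le.
apply: le_trans (vle_trans (pt_s n) _ _) _; rewrite leUx; apply/andP; split.
  by join_le.
by apply: le_trans (vle_trans (pt_o n) _ _) _; join_le.
Qed.

(** Distinct new elements are comparable only through an interpolant in [X]. *)
Let vN n n' : D :=
  dinf (fun u => (n = n' /\ u = \bot) \/ exists z, u = U n z `|` L n' z).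

Let vN_lb n n' z : vN n n' <= U n z `|` L n' z.
Proof. by apply: dinf_lb => //; right; exists z. Qed.

Let vN_glb (w e : D) n n' : (n = n' -> w <= e) ->
  (forall z, w <= e `|` (U n z `|` L n' z)) -> w <= e `|` vN n n'.
Proof.
move=> weq wz; apply: dinf_glb => // [|_ [[nn' ->]|[z ->]] //].
  by exists (U n (pt_o n) `|` L n' (pt_o n)); right; exists (pt_o n).
by rewrite joinx0 weq.
Qed.

Let vN_glbl (w e : D) n n' : (n = n' -> w <= e) ->
  (forall z, w <= (U n z `|` L n' z) `|` e) -> w <= vN n n' `|` e.
Proof. by move=> weq wz; rewrite joinC; apply: vN_glb => // z; rewrite joinC. Qed.

Let P := (X + newpt)%type.

Let v (p q : P) : D :=
  match p, q with
  | inl x, inl y => vle x y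
  | inl x, inr n => L n x
  | inr n, inl x => U n x
  | inr n, inr n' => vN n n'
  end.

Let v_refl p : v p p = \bot.
Proof.
case: p => x; first exact: vle_refl.
by apply/eqP; rewrite -lex0; apply: dinf_lb => //; left.
Qed.

Let v_trans q p r : v p r <= v p q `|` v q r.
Proof.
case: p q r => [x|n] [y|n'] [z|n''] /=.
- exact: vle_trans.
- exact: L_trans.
- exact: LU.
- apply: vN_glb => [->//|z]; apply: le_trans (L_trans _ _ z) _.
  by rewrite joinA leU2 ?LU.
- exact: U_trans.
- exact: vN_lb.
- apply: vN_glbl => [->//|w]; apply: le_trans (U_trans _ w _) _.
  by rewrite -joinA leU2 ?LU.
- apply: vN_glb => [->//|z]; apply: vN_glbl => [->|w].
    exact: vN_lb.
  apply: le_trans (vN_lb _ _ w) _; rewrite -joinA leU2 //.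
  by apply: le_trans (L_trans _ _ z) _; rewrite joinA leU2 ?LU.
Qed.

Variant adj_join : P -> P -> P -> Prop :=
  | AdjJoin x y : adj_join (inl x) (inl y) (inl (vjoin x y))
  | AdjJoinNew n : adj_join (inr n) (inl (pt_s n)) (inl (pt_j n)).

Variant adj_meet : P -> P -> P -> Prop :=
  | AdjMeet x y : adj_meet (inl x) (inl y) (inl (vmeet x y))
  | AdjMeetNew n : adj_meet (inr n) (inl (pt_t n)) (inl (pt_o n)).

Let v_nj n : v (inr n) (inl (pt_j n)) = \bot.
Proof. by apply/eqP; rewrite -lex0 -[leRHS](vle_refl (pt_j n)); apply: dmeet_l. Qed.

Let v_on n : v (inl (pt_o n)) (inr n) = \bot.
Proof. by apply/eqP; rewrite -lex0 -[leRHS](vle_refl (pt_o n)); apply: dmeet_l. Qed.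

Let v_homol p q r : v p q = \bot -> v p r <= v q r.
Proof. by move=> pq; apply: le_trans (v_trans q p r) _; rewrite pq join0x. Qed.

Let v_homor p q r : v q r = \bot -> v p r <= v p q.
Proof. by move=> qr; apply: le_trans (v_trans q p r) _; rewrite qr joinx0. Qed.

Let adj_join_sup a b c : adj_join a b c -> forall p, v c p = v a p `|` v b p.
Proof.
case=> [x y|n] p.
  case: p => [z|n] /=; first exact: vle_joinl.
  apply: le_anti; rewrite L_join leUx /=; apply/andP; split.
    by apply: (@v_homol (inl x) (inl _) (inr n)); apply: vle_ul.
  by apply: (@v_homol (inl y) (inl _) (inr n)); apply: vle_ur.
have nP := ptP n.
apply: le_anti; rewrite leUx; apply/andP; split; last first.
  by apply/andP; split; apply: v_homol => //; apply: adj_sj nP.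
case: p => [w|n'] /=.
  apply: dmeet_glbl; first by join_le.
  by apply: le_trans (vle_trans (pt_s n) _ _) _; join_le.
apply: vN_glbl => [<-|z].
  (* If n' = n, then s <= n forces s <= o, and the second alternative of [L] puts j below n. *)
  rewrite -[leRHS]join0x; apply: dmeet_glb; apply: le_trans (dmeet_r _ _) _;
    by rewrite vle_refl joinx0 join0x; join_le.
(* If n <= z <= n' and s <= n', then z \/ s is above n and s, hence above j, and it is below n' by
   [L_join]. *)
apply: le_trans (L_trans _ _ (vjoin z (pt_s n))) _; rewrite leUx.
apply/andP; split; last by apply: le_trans (L_join _ _ _) _; join_le.
apply: (@le_trans _ _ (U n z)); last by join_le.
apply: (@le_trans _ _ (U n (vjoin z (pt_s n)))).
  rewrite -[leRHS]join0x; apply: dmeet_glb; first exact: leUr.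
  apply: le_trans (vle_trans (pt_s n) _ _) _.
  by rewrite vle_ur joinx0; join_le.
by apply: le_trans (U_trans _ z _) _; rewrite vle_ul joinx0.
Qed.

(** The element t does not occur in [U] or [L]; it enters through the two inequalities of
    [adjoinable]. If w <= n holds by the second alternative, then s <= o, and [adj_lower] turns w <=
    t into w <= o. If n <= t holds because j <= t, then [adj_upper] gives j <= s, hence n <= o. *)
Let adj_meet_inf a b c : adj_meet a b c -> forall p, v p c = v p a `|` v p b.
Proof.
case=> [x y|n] p.
  case: p => [z|n] /=; first exact: vle_meetr.
  apply: le_anti; rewrite U_meet leUx /=; apply/andP; split.
    by apply: (@v_homor (inr n) (inl _) (inl x)); apply: vle_ml.
  by apply: (@v_homor (inr n) (inl _) (inl y)); apply: vle_mr.
have nP := ptP n.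
apply: le_anti; rewrite leUx; apply/andP; split; last first.
  by apply/andP; split; apply: v_homor => //; apply: adj_ot nP.
case: p => [w|n'] /=.
  apply: dmeet_glbl; first by join_le.
  apply: le_trans (vle_trans (pt_t n) _ _) _; rewrite leUx; apply/andP; split.
    by join_le.
  by apply: le_trans (adj_lower nP) _; join_le.
apply: vN_glbl => [->|z].
  rewrite -[leRHS]join0x; apply: dmeet_glb; apply: le_trans (dmeet_r _ _) _;
    rewrite vle_refl joinx0 join0x; last by join_le.
  exact: adj_upper nP.
apply: le_trans (U_trans _ (vmeet z (pt_t n)) _) _; rewrite leUx.
apply/andP; split; first by apply: le_trans (U_meet _ _ _) _; join_le.
apply: (@le_trans _ _ (L n z)); last by join_le.
apply: (@le_trans _ _ (L n (vmeet z (pt_t n)))).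
  rewrite -[leRHS]join0x; apply: dmeet_glb; first exact: leUr.
  apply: le_trans (vle_trans (pt_t n) _ _) _.
  by rewrite vle_mr !join0x; apply: le_trans (adj_lower nP) _; join_le.
by apply: le_trans (L_trans _ _ z) _; rewrite vle_ml join0x.
Qed.

Lemma adjunction (B : vlat D) (k : B -> X) : vhom idfun k ->
    (forall x, exists b b', vle (k b) x = \bot /\ vle x (k b') = \bot) ->
  exists (Y : vlat D) (g : X -> Y),
  [/\ vhom idfun g,
      forall o s t j, adjoinable o s t j -> exists y : Y,
        veq (g j) (vjoin y (g s)) /\ veq (g o) (vmeet y (g t)) &
      forall y, exists b b', vle (g (k b)) y = \bot /\ vle y (g (k b')) = \bot].
Proof.
move=> hk kbd.
have [|p|Y [i [iv iJ iM ibd]]] := @completion _ _ mc P v adj_join adj_meet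
  v_refl v_trans adj_join_sup adj_meet_inf B (inl \o k).
- by move=> a b; rewrite /= (vhom_vle hk).
- case: p => [x|n]; first exact: kbd.
  (* A new element lies between its o and its j and inherits their bounds. *)
  have [[b [_ [bo _]]] [_ [b' [_ jb']]]] := (kbd (pt_o n), kbd (pt_j n)).
  exists b, b'; split; apply/eqP; rewrite -lex0.
    by apply: le_trans (v_trans (inl (pt_o n)) _ _) _; rewrite v_on /= bo joinxx.
  by apply: le_trans (v_trans (inl (pt_j n)) _ _) _; rewrite v_nj /= jb' joinxx.
exists Y, (i \o inl); split=> //.
  by split=> x y /=; [rewrite iv|apply: iJ; constructor|apply: iM; constructor].
move=> o s t j adj; exists (i (inr (Newpt adj))); split.
  exact: (iJ _ _ _ (AdjJoinNew (Newpt adj))).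
exact: (iM _ _ _ (AdjMeetNew (Newpt adj))).
Qed.

End Adjunction.

(** * The lattice underlying a valued lattice *)

Fact vquot_display : Order.disp_t. Proof. exact: Order.Disp tt tt. Qed.

Section Quotient.
Context {dD : Order.disp_t} {D : bJoinSemilatticeType dD} (X : vlat D).

Definition vtype : Type := vcar X.
HB.instance Definition _ := gen_eqMixin vtype.
HB.instance Definition _ := gen_choiceMixin vtype.

Definition vequiv : rel vtype := fun x y => `[< @veq _ _ X x y >].

Fact vequiv_refl : reflexive vequiv.
Proof. by move=> x; apply/asboolP; apply: veq_refl. Qed.

Fact vequiv_sym : symmetric vequiv.
Proof. by move=> x y; apply/asboolP/asboolP; apply: veq_sym. Qed.

Fact vequiv_trans : transitive vequiv.
Proof. by move=> y x z /asboolP xy /asboolP yz; apply/asboolP; apply: veq_trans xy yz. Qed.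

Canonical vequiv_equiv := EquivRel vequiv vequiv_refl vequiv_sym vequiv_trans.

Definition vquot := {eq_quot vequiv}%qT.
HB.instance Definition _ := Choice.on vquot.

Definition vclass (x : X) : vquot := (\pi_vquot (x : vtype))%qT.
Definition vrepr (a : vquot) : X := repr a.

Lemma vreprK : cancel vrepr vclass.
Proof. exact: reprK. Qed.

Lemma vclass_eq (x y : X) : vclass x = vclass y <-> veq x y.
Proof. by split=> [/eqmodP/asboolP|h]; last apply/eqmodP/asboolP. Qed.

Lemma veq_vclassK (x : X) : veq (vrepr (vclass x)) x.
Proof. by apply/vclass_eq; rewrite vreprK. Qed.

Definition vquot_vle (a b : vquot) : D := vle (vrepr a) (vrepr b).

Lemma vquot_vleE (x y : X) : vquot_vle (vclass x) (vclass y) = vle x y.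
Proof.
rewrite /vquot_vle (veq_vlel _ (veq_vclassK x)).
exact: veq_vler (veq_vclassK y).
Qed.

Definition vquot_le (a b : vquot) : bool := vquot_vle a b == \bot.

Fact vquot_le_refl : reflexive vquot_le.
Proof. by move=> a; apply/eqP/vle_refl. Qed.

Fact vquot_le_anti : antisymmetric vquot_le.
Proof.
by move=> a b /andP[/eqP ab /eqP ba]; rewrite -[a]vreprK -[b]vreprK; apply/vclass_eq.
Qed.

Fact vquot_le_trans : transitive vquot_le.
Proof. by move=> b a c /eqP ab /eqP bc; apply/eqP; apply: vle_trans0 ab bc. Qed.

HB.instance Definition _ := Order.Le_isPOrder.Build vquot_display vquot
  vquot_le_refl vquot_le_anti vquot_le_trans.

Definition vquot_meet (a b : vquot) : vquot := vclass (vmeet (vrepr a) (vrepr b)).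
Definition vquot_join (a b : vquot) : vquot := vclass (vjoin (vrepr a) (vrepr b)).

Lemma vquot_vle_meetr a b c :
  vquot_vle a (vquot_meet b c) = vquot_vle a b `|` vquot_vle a c.
Proof. by rewrite -[a]vreprK vquot_vleE vle_meetr -!vquot_vleE !vreprK. Qed.

Lemma vquot_vle_joinl a b c :
  vquot_vle (vquot_join a b) c = vquot_vle a c `|` vquot_vle b c.
Proof. by rewrite -[c]vreprK vquot_vleE vle_joinl -!vquot_vleE !vreprK. Qed.

Fact vquot_lexI (a b c : vquot) : (a <= vquot_meet b c) = (a <= b) && (a <= c).
Proof. by rewrite /Order.le /= /vquot_le vquot_vle_meetr join_eq0. Qed.

Fact vquot_leUx (a b c : vquot) : (vquot_join a b <= c) = (a <= c) && (b <= c).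
Proof. by rewrite /Order.le /= /vquot_le vquot_vle_joinl join_eq0. Qed.

HB.instance Definition _ := Order.POrder_isMeetSemilattice.Build
  vquot_display vquot vquot_lexI.
HB.instance Definition _ := Order.POrder_isJoinSemilattice.Build
  vquot_display vquot vquot_leUx.

Lemma vquot_leE (a b : vquot) : (a <= b) = (vquot_vle a b == \bot).
Proof. by []. Qed.

Lemma vclass_join (x y : X) : vclass (vjoin x y) = vclass x `|` vclass y.
Proof. by apply/vclass_eq; apply: veq_join; apply: veq_sym; apply: veq_vclassK. Qed.

Lemma vclass_meet (x y : X) : vclass (vmeet x y) = vclass x `&` vclass y.
Proof. by apply/vclass_eq; apply: veq_meet; apply: veq_sym; apply: veq_vclassK. Qed.

End Quotient.
Arguments vclass {dD D X}.

(** * From values to congruences of the extension *)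

Section ValuedExtension.
Context {d d' : Order.disp_t} {K : latticeType d} {L : latticeType d'}.
Variables (f : {lmorphism K -> L}) (w : L -> L -> conc K) (x0 : K).
Hypothesis w_le : forall a b, w a b = \bot <-> a <= b.
Hypothesis w_trans : forall b a c, w a c <= w a b `|` w b c.
Hypothesis w_joinl : forall a b c, w (a `|` b) c = w a c `|` w b c.
Hypothesis w_meetr : forall a b c, w a (b `&` c) = w a b `|` w a c.
Hypothesis w_f : forall x y, w (f x) (f y) = cg x y.
Hypothesis w_adj : forall o s t j, o <= s -> o <= t -> s <= j -> t <= j ->
  w t o <= w s o -> w j s <= w j t -> exists n, n `|` s = j /\ n `&` t = o.
Hypothesis f_bound : forall a, exists x y, f x <= a <= f y.
Implicit Types (a b c o s t : L) (theta : L -> L -> Prop).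

Let w_refl a : w a a = \bot.
Proof. exact/w_le. Qed.

Let w_homol a b c : a <= b -> w a c <= w b c.
Proof. by move=> /w_le ab; apply: le_trans (w_trans b a c) _; rewrite ab join0x. Qed.

Lemma valued_complemented : relatively_complemented L.
Proof.
move=> a b x /andP[ax xb].
by have [y [? ?]] := w_adj ax ax xb xb (lexx _) (lexx _); exists y; rewrite meetC joinC.
Qed.

Let congr_interval theta a b : congruence theta ->
  theta a b <-> theta (a `&` b) (a `|` b).
Proof.
move=> ct; split=> h.
  apply: (congr_trans ct (y := b)).
    by have := congr_meet ct h (congr_refl ct b); rewrite meetxx.
  by have := congr_join ct (congr_sym ct h) (congr_refl ct b); rewrite joinxx.
apply: (congr_trans ct (y := a `&` b)).
  have := congr_meet ct (congr_refl ct a) h.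
  rewrite (meet_l (leUl _ _)) (meet_r (leIl _ _)); exact: congr_sym.
have := congr_meet ct (congr_refl ct b) h.
by rewrite (meet_l (leUr _ _)) (meet_r (leIr _ _)).
Qed.

(* An element [n] with [n \/ s = s \/ t] and [n /\ t = o] carries the collapse
   of [o, s] to that of [o, t]. *)
Let collapse_disjoint theta o s t : congruence theta -> o <= s -> o <= t ->
  s `&` t = o -> w t o <= w s o -> theta o s -> theta o t.
Proof.
move=> ct os ot sto wts th.
have [|n [ns nt]] := w_adj os ot (leUl _ _) (leUr _ _) wts.
  rewrite !w_joinl !w_refl join0x joinx0.
  have <- : w t o = w t s by rewrite -sto w_meetr w_refl joinx0.
  by have <- : w s o = w s t by rewrite -sto w_meetr w_refl join0x.
have on : o <= n by rewrite -nt leIl.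
have := congr_join ct (congr_refl ct n) th; rewrite ns (join_l on).
by move/(congr_meet ct)/(_ (congr_refl ct t)); rewrite nt (meet_r (leUr _ _)).
Qed.

(** A complement [u] of s /\ t in [o, t] is disjoint from [s], so the disjoint case collapses it to
    [o]. Meeting with [t] collapses s /\ t to a part of [o], and the join of the two parts is
    [t]. *)
Let collapse_same_bottom theta o s t : congruence theta -> o <= s -> o <= t ->
  w t o <= w s o -> theta o s -> theta o t.
Proof.
move=> ct os ot wts th.
have [|u [uo ut]] := @valued_complemented o t (s `&` t).
  by rewrite lexI os ot leIr.
have ut' : u <= t by rewrite -ut leUr.
have ou : o <= u by rewrite -uo leIr.
have hu : theta o u.
  apply: (collapse_disjoint ct os ou) th.
    by rewrite -uo -meetA (meet_r ut').
  exact: le_trans (w_homol _ ut') wts.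
have hm := congr_meet ct th (congr_refl ct t).
by have := congr_join ct hm hu; rewrite ut (meet_l ot) joinxx.
Qed.

(** With [s] a complement of [a] in [o, b], the intervals [o, s] and [a, b] are perspective. This
    moves intervals to a common bottom. *)
Let transpose o a b : o <= a -> a <= b -> exists s,
  [/\ o <= s, w s o = w b a &
      forall theta, congruence theta -> theta o s <-> theta a b].
Proof.
move=> oa ab; have [|s [sa sb]] := @valued_complemented o b a; first by rewrite oa.
exists s; split; first by rewrite -sa leIr.
  by rewrite -sb -sa w_joinl w_meetr !w_refl joinx0 join0x.
move=> theta ct; split=> h.
  by have := congr_join ct (congr_refl ct a) h; rewrite sb (join_l oa).
have := congr_meet ct h (congr_refl ct s).
by rewrite sa (meet_r (_ : s <= b)) // -sb leUr.
Qed.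

Lemma collapse theta a b c e : congruence theta -> a <= b -> c <= e ->
  w e c <= w b a -> theta a b -> theta c e.
Proof.
move=> ct ab ce wcab th.
have [s [os ws hs]] := @transpose (a `&` c) a b (leIl _ _) ab.
have [t [ot wt ht]] := @transpose (a `&` c) c e (leIr _ _) ce.
apply/(ht _ ct); apply: (collapse_same_bottom ct os ot); first by rewrite ws wt.
exact/(hs _ ct).
Qed.

(** The intervals given by the pairs are transposed to a common bottom, where the join of their tops
    collapses exactly when each of them does. So every compact congruence of [K] is the value of one
    interval of [L]. The empty list gives a trivial interval at [f x0]. *)
Let collapse_seq (l : seq (K * K)) : exists o s,
  [/\ o <= s, w s o = conc_seq l & forall theta, congruence theta ->
      (theta o s <-> forall x y, (x, y) \in l -> theta (f x) (f y))].
Proof.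
elim: l => [|[x y] l [o' [s' [os' ws' hs']]]].
  exists (f x0), (f x0); split=> //.
    by rewrite w_refl; apply/esym/eqP; rewrite -lex0; apply/conc_seq_le.
  by move=> theta ct; split=> // _; apply: congr_refl.
have xy : f (x `&` y) <= f (x `|` y) by rewrite omorphI omorphU lexUl ?leIl.
set o := o' `&` f (x `&` y).
have [s [os ws hs]] := @transpose o _ _ (leIl _ _) os'.
have [t [ot wt ht]] := @transpose o _ _ (leIr _ _) xy.
exists o, (s `|` t); split; first by rewrite lexUl.
  rewrite w_joinl ws wt ws' w_f; apply: eq_from_ub => a.
  apply/idP/idP; rewrite leUx.
    case/andP=> /conc_seq_le la /cg_le xya; apply/conc_seq_le => u v.
    rewrite inE => /orP[/eqP[-> ->]|/la //].
    have ca := conc_congruence a.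
    move: xya => /(leC_joinl ca)[/(leC_meetr ca)[_ xya] /(leC_meetr ca)[yxa _]].
    exact/(congrE ca).
  move/conc_seq_le => h; apply/andP; split.
    by apply/conc_seq_le => u v uv; apply: h; rewrite inE uv orbT.
  have ca := conc_congruence a.
  have /(congrE ca)[xya yxa] : a x y by apply: h; rewrite mem_head.
  apply/cg_le/(leC_joinl ca); split; apply/(leC_meetr ca); split=> //;
    exact: (leC_le ca).
move=> theta ct; split=> [h u v|h].
  have hos : theta o s.
    have := congr_meet ct h (congr_refl ct s).
    by rewrite (meet_l os) (meet_r (leUl _ _)).
  have hot : theta o t.
    have := congr_meet ct h (congr_refl ct t).
    by rewrite (meet_l ot) (meet_r (leUr _ _)).
  rewrite inE => /orP[/eqP[-> ->]|]; last exact: (hs' _ ct).1 ((hs _ ct).1 hos) u v.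
  by apply/congr_interval => //; rewrite -omorphI -omorphU; apply/(ht _ ct).
rewrite -[o]joinxx; apply: (congr_join ct).
  apply/(hs _ ct)/(hs' _ ct) => u v uv; apply: h; by rewrite inE uv orbT.
apply/(ht _ ct); rewrite omorphI omorphU; apply: (congr_interval _ _ ct).1.
by apply: h; rewrite mem_head.
Qed.

(** The interval which [collapse_seq] attaches to this value has the same value as [s /\ t, s \/ t],
    so by [collapse] each of the two forces the other. *)
Let conc_map_principal s t : conc_map f (w (s `|` t) (s `&` t)) = conc_seq [:: (s, t)].
Proof.
set e := w _ _; have [l el] := conc_fin_gen e.
have {}el : e = conc_seq l by apply: conc_inj.
have [o [u [ou wu hu]]] := collapse_seq l.
have st : s `&` t <= s `|` t by rewrite lexUl ?leIl.
apply: eq_from_ub => c; have cc := conc_congruence c; rewrite el.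
apply/idP/idP.
  move/conc_map_gen_le/(hu _ cc) => cou; apply/conc_seq_le => _ _ /[!inE]/eqP[-> ->].
  by apply: (congr_interval _ _ cc).2; apply: collapse cou; rewrite // wu -el.
move/conc_seq_le => h; apply/conc_map_gen_le/(hu _ cc).
apply: (collapse cc st) => //; first by rewrite wu -el.
by apply: (congr_interval _ _ cc).1; apply: h; rewrite mem_head.
Qed.

Let conc_map_surj (c : conc L) : exists a : conc K, conc_map f a = c.
Proof.
have [l cl] := conc_fin_gen c.
have {cl} -> : c = conc_seq l by apply: conc_inj.
elim: l => [|[s t] l [a IH]].
  exists \bot; rewrite conc_map0; apply/esym/eqP; rewrite -lex0.
  exact/conc_seq_le.
exists (w (s `|` t) (s `&` t) `|` a); rewrite conc_map_join conc_map_principal IH.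
apply: eq_from_ub => b; apply/idP/idP; rewrite leUx.
  case/andP=> /conc_seq_le h1 /conc_seq_le h2; apply/conc_seq_le => x y.
  by rewrite inE => /orP[xy|/h2 //]; apply: h1; rewrite inE.
move/conc_seq_le => h; apply/andP; split; apply/conc_seq_le => x y xy; apply: h.
  by move: xy; rewrite !inE => ->.
by rewrite inE xy orbT.
Qed.

(** The relation [beta] is a congruence of [L] that contains the extension of [b] and restricts to
    [b] on [K]. *)
Let conc_map_reflects (a b : conc K) : conc_map f a <= conc_map f b -> a <= b.
Proof.
pose beta s t := w s t `|` w t s <= b.
have cbeta : congruence beta.
  rewrite /beta; split.
  - by move=> s; rewrite w_refl join0x le0x.
  - by move=> s t; rewrite joinC.
  - move=> s t u; rewrite !leUx => /andP[st ts] /andP[tu ut]; apply/andP; split.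
      by apply: le_trans (w_trans t _ _) _; rewrite leUx st tu.
    by apply: le_trans (w_trans t _ _) _; rewrite leUx ts ut.
  - move=> s s' t t'; rewrite !leUx !w_meetr !leUx.
    move=> /andP[s1 s2] /andP[t1 t2]; apply/andP; split; apply/andP; split.
    + exact: le_trans (w_homol _ (leIl _ _)) s1.
    + exact: le_trans (w_homol _ (leIr _ _)) t1.
    + exact: le_trans (w_homol _ (leIl _ _)) s2.
    + exact: le_trans (w_homol _ (leIr _ _)) t2.
  - have homor c u v : u <= v -> w c v <= w c u.
      by move=> /w_le uv; apply: le_trans (w_trans u c v) _; rewrite uv joinx0.
    move=> s s' t t'; rewrite !leUx !w_joinl !leUx.
    move=> /andP[s1 s2] /andP[t1 t2]; apply/andP; split; apply/andP; split.
    + exact: le_trans (homor _ _ _ (leUl _ _)) s1.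
    + exact: le_trans (homor _ _ _ (leUr _ _)) t1.
    + exact: le_trans (homor _ _ _ (leUl _ _)) s2.
    + exact: le_trans (homor _ _ _ (leUr _ _)) t2.
move=> ab; apply/conc_leP => x y axy.
have : beta (f x) (f y).
  have /conc_leP/(_ _ _ (conc_map_congr (f := f) axy)) := ab.
  apply: (con_gen_min cbeta) => _ _ [x' [y' [bxy -> ->]]].
  rewrite /beta !w_f leUx; have /(congrE (conc_congruence b))[? ?] := bxy.
  by apply/andP; split; apply/cg_le.
rewrite /beta !w_f leUx => /andP[/cg_le ? /cg_le ?].
exact/(congrE (conc_congruence b)).
Qed.

Lemma valued_extension : [/\ injective f, congruence_preserving f,
  relatively_complemented L & convex_generates (range f)].
Proof.
split.
- move=> x y fxy; apply: le_anti; apply/andP.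
  by split; apply/cg_eq0; rewrite -w_f fxy w_refl.
- split; [|exact: conc_map_join|exact: conc_map0].
  have /choice[g fg] := conc_map_surj; exists g => // a.
  by apply: le_anti; apply/andP; split; apply: conc_map_reflects; rewrite fg.
- exact: valued_complemented.
move=> C convC fC a; have [x [y /andP[xa ay]]] := f_bound a.
by apply: (convC (f x) a (f y)); rewrite ?xa ?ay //; apply: fC; [exists x|exists y].
Qed.

End ValuedExtension.

(** * Inclusions of sublattices and change of values *)

Lemma conc_map_comp d1 d2 d3 (K1 : latticeType d1) (K2 : latticeType d2)
    (K3 : latticeType d3) (f : {lmorphism K2 -> K3}) (g : {lmorphism K1 -> K2})
    (e : {lmorphism K1 -> K3}) : (forall x, e x = f (g x)) ->
  forall a : conc K1, conc_map f (conc_map g a) = conc_map e a.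
Proof.
move=> efg a; apply: le_anti; apply/andP; split; apply/conc_map_le.
  apply: con_gen_min => [|_ _ [x [y [axy -> ->]]]].
    exact: preimage_congruence (conc_congruence _).
  by rewrite -!efg; apply: conc_map_congr.
by move=> x y axy; rewrite !efg; do 2 apply: conc_map_congr.
Qed.

Section Inclusion.
Context {d : Order.disp_t} {K : latticeType d} {S T : latticeClosed K}.
Variable ST : {subset S <= T}.

Definition incl (x : sublattice S) : sublattice T := Sublattice (ST (valP x)).

Fact incl_homo : {homo incl : x y / x <= y}.
Proof. by move=> x y; rewrite -!Order.le_val. Qed.

Fact incl_meet : Order.meet_morphism incl.
Proof. by move=> x y; apply: val_inj. Qed.

Fact incl_join : Order.join_morphism incl.
Proof. by move=> x y; apply: val_inj. Qed.

HB.instance Definition _ :=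
  Order.isOrderMorphism.Build d _ d _ incl incl_homo.
HB.instance Definition _ :=
  Order.isLatticeMorphism.Build d _ d _ incl incl_meet incl_join.

End Inclusion.

Section Underlying.
Context {d : Order.disp_t} {K : latticeType d} {S : latticeClosed K}.

Definition underlying (x : sublattice S) : K := val x.

Fact underlying_homo : {homo underlying : x y / x <= y}.
Proof. by move=> x y; rewrite -Order.le_val. Qed.

Fact underlying_meet : Order.meet_morphism underlying.
Proof. by []. Qed.

Fact underlying_join : Order.join_morphism underlying.
Proof. by []. Qed.

HB.instance Definition _ :=
  Order.isOrderMorphism.Build d _ d _ underlying underlying_homo.
HB.instance Definition _ :=
  Order.isLatticeMorphism.Build d _ d _ underlying underlying_meet underlying_join.

End Underlying.

Section Push.
Context {dD : Order.disp_t} {D : bJoinSemilatticeType dD}.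
Context {dE : Order.disp_t} {E : bJoinSemilatticeType dE}.
Variable h : D -> E.
Hypotheses (hU : {morph h : a b / a `|` b}) (h0 : h \bot = \bot).

Lemma morph_homo a b : a <= b -> h a <= h b.
Proof. by move=> /join_r <-; rewrite hU leUl. Qed.

Let push_refl (X : vlat D) (x : X) : h (vle x x) = \bot.
Proof. by rewrite vle_refl. Qed.

Let push_trans (X : vlat D) (y x z : X) :
  h (vle x z) <= h (vle x y) `|` h (vle y z).
Proof. by rewrite -hU; apply/morph_homo/vle_trans. Qed.

Let push_joinl (X : vlat D) (x y z : X) :
  h (vle (vjoin x y) z) = h (vle x z) `|` h (vle y z).
Proof. by rewrite -hU vle_joinl. Qed.

Let push_meetr (X : vlat D) (x y z : X) :
  h (vle x (vmeet y z)) = h (vle x y) `|` h (vle x z).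
Proof. by rewrite -hU vle_meetr. Qed.

(** The axioms of [vlat] involve only finite joins and [\bot], so they survive every homomorphism of
    semilattices with zero, whatever it does to infima. *)
Definition vpush (X : vlat D) : vlat E := Vlat (@push_refl X) (@push_trans X)
  (@push_joinl X) (@push_meetr X).

Lemma veq_push (X : vlat D) (x y : X) : veq x y -> @veq _ _ (vpush X) x y.
Proof. by case=> xy yx; split; rewrite /= ?xy ?yx. Qed.

End Push.

(** Before [m] the sequence is filled with [x0]. Induction on [m] over the shifted family avoids
    transport along equalities of indices. *)
Lemma thread_extension (X : nat -> Type) (g : forall n, X n -> X n.+1)
    (x0 : forall n, X n) (m : nat) (y : X m) :
  exists s : forall n, X n, s m = y /\ forall n, (m <= n)%N -> s n.+1 = g n (s n).
Proof.
elim: m X g x0 y => [|m IH] X g x0 y.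
  by exists (nat_rect X y g).
have [s [sm sg]] := IH (fun n => X n.+1) (fun n => g n.+1) (fun n => x0 n.+1) y.
by exists (fun n => if n is n'.+1 then s n' else x0 0%N); split=> // -[|n] //; apply: sg.
Qed.

(** * The chain of stages and its limit *)

Section Chain.
Context {d : Order.disp_t} {K : latticeType d}.
Variables (N : nat -> latticeClosed K) (x0 : K).
Hypothesis N_sub : forall n, {subset N n <= N n.+1}.
Hypothesis N_cover : forall x, exists n, x \in N n.
Hypothesis x0N : x0 \in N 0%N.
Hypothesis N_mc : forall n, meet_continuous (conc (sublattice (N n))).

Local Notation Kn n := (sublattice (N n)).
Local Notation Dn n := (conc (Kn n)).

Let h n : Dn n -> Dn n.+1 := conc_map (incl (@N_sub n)).
Let hU n : {morph @h n : a b / a `|` b}. Proof. exact: conc_map_join. Qed.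
Let h0 n : @h n \bot = \bot. Proof. exact: conc_map0. Qed.

Let H n : Dn n -> conc K := conc_map (@underlying _ _ (N n)).
Let HU n : {morph @H n : a b / a `|` b}. Proof. exact: conc_map_join. Qed.
Let H0 n : @H n \bot = \bot. Proof. exact: conc_map0. Qed.
Let H_eq0 n (a : Dn n) : H a = \bot -> a = \bot.
Proof. by apply: conc_map_eq0; apply: val_inj. Qed.
Let Hh n (a : Dn n) : H (h a) = H a.
Proof. exact: conc_map_comp. Qed.

Let N_leq m n : (m <= n)%N -> {subset N m <= N n}.
Proof.
move=> /subnK <-; elim: (n - m)%N => [|k IH] x xm; first by [].
by rewrite addSn; apply/N_sub/IH.
Qed.

Record stage n := Stage {
  stage_vlat :> vlat (Dn n);
  stage_emb : conc_vlat (Kn n) -> stage_vlat;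
  stage_hom : vhom idfun stage_emb;
  stage_bound : forall y : stage_vlat, exists a b : Kn n,
    vle (stage_emb a) y = \bot /\ vle y (stage_emb b) = \bot }.

(** Solutions for data in [S] appear in [S'], which need not be closed under adjunction itself; the
    limit is. *)
Definition extends n (S : stage n) (S' : stage n.+1) (g : S -> S') : Prop :=
  [/\ vhom (@h n) g,
      forall a : Kn n, veq (g (stage_emb S a)) (stage_emb S' (incl (@N_sub n) a)) &
      forall o s t j : S, adjoinable o s t j -> exists y,
        veq (g j) (vjoin y (g s)) /\ veq (g o) (vmeet y (g t))].

Lemma next_stage n (S : stage n) : exists (S' : stage n.+1) (g : S -> S'), extends g.
Proof.
pose A := vpush (@hU n) (@h0 n) (conc_vlat (Kn n)).
pose X := vpush (@hU n) (@h0 n) S.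
pose B := conc_vlat (Kn n.+1).
(* The point [x0], present in every [N n], makes the infima over interpolants range over nonempty
   sets. *)
pose a0 : Kn n := Sublattice (N_leq (leq0n n) x0N).
have hX : vhom idfun (stage_emb S : A -> X).
  have [vS jS mS] := stage_hom S.
  split=> x y; first exact: (congr1 (@h n) (vS x y)).
    exact: (veq_push (@hU n) (@h0 n) (jS x y)).
  exact: (veq_push (@hU n) (@h0 n) (mS x y)).
have hB : vhom idfun (incl (@N_sub n) : A -> B).
  split=> x y; first by rewrite /= /h conc_map_cg.
    by rewrite [X in veq X _]omorphU; apply: veq_refl.
  by rewrite [X in veq X _]omorphI; apply: veq_refl.
have Xb (x : X) : exists a a' : A, vle (stage_emb S a : X) x = \bot /\
    vle x (stage_emb S a' : X) = \bot.
  by have [a [b [ax xb]]] := stage_bound x; exists a, b; rewrite /= ax xb h0.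
have [Y [gX [gB [hgX hgB comm Yb]]]] := @amalgam _ _ (@N_mc n.+1) A X B _ _ a0 hX hB Xb.
have [Z [g [hg adj Zb]]] := adjunction (@N_mc n.+1) hgB Yb.
have hgB' := vhom_comp (erefl : idfun \bot = \bot) hgB hg.
exists (Stage hgB' Zb), (g \o gX); split=> /= [|a|o s t j].
- have [v1 j1 m1] := vhom_comp (erefl : idfun \bot = \bot) hgX hg.
  by split=> x y; [rewrite v1|apply: j1|apply: m1].
- by apply: (vhom_veq hg).
case=> os ot sj tj low up; apply: adj; split; rewrite !(vhom_vle hgX) /=.
- by rewrite os h0.
- by rewrite ot h0.
- by rewrite sj h0.
- by rewrite tj h0.
- exact: (morph_homo (@hU n)).

- exact: (morph_homo (@hU n)).

Qed.

Let stage0 : stage 0.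
Proof.
apply: (@Stage 0%N (conc_vlat (Kn 0%N)) idfun).
  by split=> // x y; apply: veq_refl.
by move=> y; exists y, y; rewrite vle_refl.
Defined.

Let next n (S : stage n) : {S' : stage n.+1 & {g : S -> S' | extends g}}.
Proof. by have /cid[S' /cid[g e]] := next_stage S; exists S', g. Qed.

Fixpoint st n : stage n :=
  if n is m.+1 then projT1 (next (st m)) else stage0.

Let g n : st n -> st n.+1 := sval (projT2 (next (st n))).
Let gP n : extends (@g n). Proof. exact: svalP (projT2 (next (st n))). Qed.

(** Points outside [N n] are sent to [x0], so that every [x] has a term at every stage. *)
Let emb n (x : K) : Kn n := insubd (Sublattice (N_leq (leq0n n) x0N)) x.

Let embK n x : x \in N n -> val (emb n x) = x.
Proof. exact: insubdK. Qed.

Let emb_incl n x : x \in N n -> incl (@N_sub n) (emb n x) = emb n.+1 x.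
Proof. by move=> xn; apply: val_inj; rewrite /= !embK //; apply: N_sub. Qed.

Let coherent (s : forall n, st n) m :=
  forall n, (m <= n)%N -> veq (g (s n)) (s n.+1).

Let coherentW s m n : (m <= n)%N -> coherent s m -> coherent s n.
Proof. by move=> mn cs k nk; apply: cs; apply: leq_trans nk. Qed.

(** An element of the direct limit as a sequence through all stages, arbitrary before
    [thread_start]. Operations are then termwise. *)
Record thread := Thread {
  thread_start : nat;
  thread_seq :> forall n, st n;
  threadP : coherent thread_seq thread_start }.
Arguments threadP : clear implicits.

Let val_at n (s t : forall n, st n) : conc K := H (vle (s n) (t n)).

Let vle_next s t n : coherent s n -> coherent t n ->
  vle (s n.+1) (t n.+1) = h (vle (s n) (t n)).
Proof.
move=> cs ct; have [hg _ _] := gP n.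
by rewrite -(vhom_vle hg) (veq_vlel _ (cs n _)) // (veq_vler _ (ct n _)).
Qed.

Let val_at_stable s t m n : (m <= n)%N -> coherent s m -> coherent t m ->
  val_at n s t = val_at m s t.
Proof.
move=> mn cs ct; elim: n mn => [|n IH].
  by rewrite leqn0 => /eqP ->.
rewrite leq_eqVlt => /orP[/eqP <- //|mn]; rewrite -IH // /val_at vle_next ?Hh //.
  exact: coherentW cs.
exact: coherentW ct.
Qed.

(** Values at different stages become comparable in Con_c K. The value is read at the first index
    past both starts, and [tleE] allows any index of coherence. *)
Let tle (s t : thread) : conc K := val_at (maxn (thread_start s) (thread_start t)) s t.

Let tleE n (s t : thread) : coherent s n -> coherent t n -> tle s t = H (vle (s n) (t n)).
Proof.
move=> cs ct; rewrite /tle; set m := maxn _ _.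
rewrite -[RHS]/(val_at n s t).
rewrite -(val_at_stable (leq_maxl m n)) -1?(val_at_stable (leq_maxr m n)) //.
- by apply: coherentW (threadP s); apply: leq_maxl.
- by apply: coherentW (threadP t); apply: leq_maxr.
Qed.

Let op_coherent (op : forall n, st n -> st n -> st n) (s t : thread) :
  (forall n x y, veq (g (op n x y)) (op n.+1 (g x) (g y))) ->
  (forall n x x' y y', veq x x' -> veq y y' -> veq (op n x y) (op n x' y')) ->
  coherent (fun n => op n (s n) (t n)) (maxn (thread_start s) (thread_start t)).
Proof.
move=> gop opW n; rewrite geq_max => /andP[sn tn].
by apply: veq_trans (gop _ _ _) _; apply: opW; apply: (threadP _).
Qed.

Let tjoin_coherent (s t : thread) : coherent (fun n => vjoin (s n) (t n))
  (maxn (thread_start s) (thread_start t)).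
Proof.
apply: (@op_coherent (fun n => @vjoin _ _ (st n)) s t) => n x y.
  by have [hg _ _] := gP n; apply: vhom_join hg x y.
exact: veq_join.
Qed.

Let tmeet_coherent (s t : thread) : coherent (fun n => vmeet (s n) (t n))
  (maxn (thread_start s) (thread_start t)).
Proof.
apply: (@op_coherent (fun n => @vmeet _ _ (st n)) s t) => n x y.
  by have [hg _ _] := gP n; apply: vhom_meet hg x y.
exact: veq_meet.
Qed.

Definition tjoin s t : thread := Thread (@tjoin_coherent s t).
Definition tmeet s t : thread := Thread (@tmeet_coherent s t).

Let common (s t u : thread) : exists n,
  [/\ coherent s n, coherent t n & coherent u n].
Proof.
exists (maxn (thread_start s) (maxn (thread_start t) (thread_start u))).
split; apply: coherentW (threadP _); first exact: leq_maxl.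
  by rewrite leq_max leq_maxl orbT.
by rewrite leq_max leq_maxr orbT.
Qed.

Let coherent_join (s t : thread) n : coherent s n -> coherent t n ->
  coherent (tjoin s t) n.
Proof.
move=> cs ct m nm; have [hg _ _] := gP m.
apply: veq_trans (vhom_join hg _ _) _; apply: veq_join; [exact: cs|exact: ct].
Qed.

Let coherent_meet (s t : thread) n : coherent s n -> coherent t n ->
  coherent (tmeet s t) n.
Proof.
move=> cs ct m nm; have [hg _ _] := gP m.
apply: veq_trans (vhom_meet hg _ _) _; apply: veq_meet; [exact: cs|exact: ct].
Qed.

Fact tle_refl s : tle s s = \bot.
Proof. by rewrite /tle /val_at vle_refl H0. Qed.

Fact tle_trans t s u : tle s u <= tle s t `|` tle t u.
Proof.
have [n [cs ct cu]] := common s t u; rewrite !(@tleE n) // -HU.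
exact/(morph_homo (@HU n))/vle_trans.
Qed.

Fact tle_joinl s t u : tle (tjoin s t) u = tle s u `|` tle t u.
Proof.
have [n [cs ct cu]] := common s t u; rewrite !(@tleE n) ?vle_joinl -?HU //.
exact: (coherent_join cs ct).
Qed.

Fact tle_meetr s t u : tle s (tmeet t u) = tle s t `|` tle s u.
Proof.
have [n [cs ct cu]] := common s t u; rewrite !(@tleE n) ?vle_meetr -?HU //.
exact: (coherent_meet ct cu).
Qed.

Definition limit_vlat : vlat (conc K) := Vlat tle_refl tle_trans tle_joinl tle_meetr.

Let limit_emb_coherent x n : x \in N n ->
  coherent (fun m => stage_emb (st m) (emb m x)) n.
Proof.
move=> xn m nm; have [_ eg _] := gP m; rewrite -emb_incl; first exact: eg.
exact: N_leq xn.
Qed.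

Definition limit_emb (x : K) : limit_vlat :=
  Thread (limit_emb_coherent (svalP (cid (N_cover x)))).

Let common2 x y : exists n, x \in N n /\ y \in N n.
Proof.
have [[m xm] [n yn]] := (N_cover x, N_cover y); exists (maxn m n).
by split; [apply: N_leq xm|apply: N_leq yn]; rewrite ?leq_maxl ?leq_maxr.
Qed.

Let tle_embE x y n : x \in N n -> y \in N n ->
  tle (limit_emb x) (limit_emb y) = cg x y.
Proof.
move=> xn yn; rewrite (@tleE n); [|exact: limit_emb_coherent..].
rewrite (vhom_vle (stage_hom _)) /= [H _]conc_map_cg /=.
by congr cg; apply: embK.
Qed.

Lemma limit_emb_hom : vhom idfun (limit_emb : conc_vlat K -> limit_vlat).
Proof.
split=> x y; have [n [xn yn]] := common2 x y.
- exact: tle_embE xn yn.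
- have xyn : x `|` y \in N n by apply: opredU.
  have exy : emb n (x `|` y) = emb n x `|` emb n y.
    by apply: val_inj; rewrite /= ?omorphU !embK.
  have cxy := coherent_join (limit_emb_coherent xn : coherent (limit_emb x) n)
    (limit_emb_coherent yn : coherent (limit_emb y) n).
  have [e1 e2] := vhom_join (stage_hom (st n)) (emb n x) (emb n y).
  split=> /=; rewrite (@tleE n) //; try exact: limit_emb_coherent.
    by rewrite /= exy e1 H0.
  by rewrite /= exy e2 H0.
- have xyn : x `&` y \in N n by apply: opredI.
  have exy : emb n (x `&` y) = emb n x `&` emb n y.
    by apply: val_inj; rewrite /= ?omorphI !embK.
  have cxy := coherent_meet (limit_emb_coherent xn : coherent (limit_emb x) n)
    (limit_emb_coherent yn : coherent (limit_emb y) n).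
  have [e1 e2] := vhom_meet (stage_hom (st n)) (emb n x) (emb n y).
  split=> /=; rewrite (@tleE n) //; try exact: limit_emb_coherent.
    by rewrite /= exy e1 H0.
  by rewrite /= exy e2 H0.
Qed.

Lemma limit_bound (t : limit_vlat) : exists x y : K,
  vle (limit_emb x) t = \bot /\ vle t (limit_emb y) = \bot.
Proof.
have ct := threadP t; set n := thread_start t in ct.
have [a [b [at_ tb]]] := stage_bound (t n).
have an := valP a; have bn := valP b.
have ea : emb n (val a) = a by apply: val_inj; rewrite embK.
have eb : emb n (val b) = b by apply: val_inj; rewrite embK.
exists (val a), (val b); split; rewrite /= (@tleE n) //; try exact: limit_emb_coherent.
  by rewrite /= ea at_ H0.
by rewrite /= eb tb H0.
Qed.

(* Compactness: an inequality between finitely generated congruences of the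
   union already holds at some stage. *)
Lemma tle_eventually (s t s' t' : thread) : tle s t <= tle s' t' ->
  exists M, forall m, (M <= m)%N -> vle (s m) (t m) <= vle (s' m) (t' m).
Proof.
have [n1 [cs1 ct1 cs'1]] := common s t s'; pose n := maxn n1 (thread_start t').
have n1n : (n1 <= n)%N by apply: leq_maxl.
have cs := coherentW n1n cs1; have ct := coherentW n1n ct1.
have cs' := coherentW n1n cs'1.
have ct' : coherent t' n by apply: coherentW (threadP t'); apply: leq_maxr.
clearbody n; rewrite (tleE cs ct) (tleE cs' ct') => /conc_leP le_n.
pose dd m := vle (s' m) (t' m).
have dS m : (n <= m)%N -> dd m.+1 = h (dd m).
  by move=> nm; apply: vle_next; [apply: coherentW cs'|apply: coherentW ct'].
(* [R] is the union, inside [K], of the congruences [dd m] at late stages. It is a congruence and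
   contains the extension of [dd n]. *)
pose R (x y : K) := exists M, forall m, (M <= m)%N -> forall x' y' : Kn m,
  val x' = x -> val y' = y -> dd m x' y'.
have emb_val m (x : K) (x' : Kn m) : val x' = x -> x' = emb m x.
  by move=> x'x; apply: val_inj; rewrite embK -x'x ?(valP x').
have cdd m := conc_congruence (dd m).
have late M1 M2 (x y : K) : exists M, [/\ (M1 <= M)%N, (M2 <= M)%N &
    forall m, (M <= m)%N -> x \in N m /\ y \in N m].
  have [k [xk yk]] := common2 x y; exists (maxn M1 (maxn M2 k)); split.
  - exact: leq_maxl.
  - by rewrite leq_max leq_maxl orbT.
  move=> m; rewrite !geq_max => /and3P[_ _ km].
  by split; apply: (N_leq km).
have cR : congruence R.
  split.
  - move=> x; exists 0%N => m _ x' y' /emb_val -> /emb_val ->.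
    exact: congr_refl (cdd m) _.
  - move=> x y [M xy]; exists M => m Mm x' y' ex ey.
    exact/(congr_sym (cdd m))/xy.
  - move=> x y z [M1 xy] [M2 yz]; have [M [M1M M2M inM]] := late M1 M2 y y.
    exists M => m Mm x' z' ex ez; have [ym _] := inM m Mm.
    apply: (congr_trans (cdd m) (y := emb m y)).
      by apply: xy => //; [apply: leq_trans Mm|apply: embK].
    by apply: yz => //; [apply: leq_trans Mm|apply: embK].
  - move=> x x' y y' [M1 xx'] [M2 yy'].
    have [M3 [M13 M23 inM3]] := late M1 M2 x x'.
    have [M [M3M _ inM]] := late M3 0%N y y'.
    exists M => m Mm u v eu ev; have M3m := leq_trans M3M Mm.
    have [xm x'm] := inM3 m M3m; have [ym y'm] := inM m Mm.
    have -> : u = emb m x `&` emb m y by apply: val_inj; rewrite /= eu !embK.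
    have -> : v = emb m x' `&` emb m y' by apply: val_inj; rewrite /= ev !embK.
    apply: (congr_meet (cdd m)).
      by apply: xx'; rewrite ?embK // (leq_trans M13).
    by apply: yy'; rewrite ?embK // (leq_trans M23).
  - move=> x x' y y' [M1 xx'] [M2 yy'].
    have [M3 [M13 M23 inM3]] := late M1 M2 x x'.
    have [M [M3M _ inM]] := late M3 0%N y y'.
    exists M => m Mm u v eu ev; have M3m := leq_trans M3M Mm.
    have [xm x'm] := inM3 m M3m; have [ym y'm] := inM m Mm.
    have -> : u = emb m x `|` emb m y by apply: val_inj; rewrite /= eu !embK.
    have -> : v = emb m x' `|` emb m y' by apply: val_inj; rewrite /= ev !embK.
    apply: (congr_join (cdd m)).
      by apply: xx'; rewrite ?embK // (leq_trans M13).
    by apply: yy'; rewrite ?embK // (leq_trans M23).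
have HR x y : H (dd n) x y -> R x y.
  apply: (con_gen_min cR) => _ _ [x' [y' [dxy -> ->]]]; exists n.
  elim=> [|m IH].
    by rewrite leqn0 => /eqP n0; subst n => u v /val_inj -> /val_inj ->.
  rewrite leq_eqVlt ltnS => /orP[/eqP nm|nm] u v eu ev.
    by subst n; rewrite (val_inj eu) (val_inj ev).
  have x'm : val x' \in N m by apply: (N_leq nm (valP x')).
  have y'm : val y' \in N m by apply: (N_leq nm (valP y')).
  rewrite (emb_val _ _ _ eu) (emb_val _ _ _ ev) -!emb_incl // dS //.
  by apply: conc_map_congr; apply: (IH nm); rewrite embK.
have [l el] := conc_fin_gen (vle (s n) (t n)).
have lR x y : (x, y) \in l -> R (val x) (val y).
  move=> xyl; apply: HR; apply: le_n.
  by apply: (conc_map_congr (f := @underlying _ _ (N n))); rewrite el; apply: con_gen_sub.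
(* As [l] is finite, one stage serves all generators. *)
have [M MR] : exists M, forall x y, (x, y) \in l -> forall m, (M <= m)%N ->
    forall x' y' : Kn m, val x' = val x -> val y' = val y -> dd m x' y'.
  elim: (l) lR => [|[x y] l' IH] lR; first by exists 0%N.
  have [|M MR] := IH; first by move=> x' y' xyl; apply: lR; rewrite inE xyl orbT.
  have [M' M'R] : R (val x) (val y) by apply: lR; rewrite mem_head.
  exists (maxn M M') => u v; rewrite inE => /orP[/eqP[-> ->]|uvl] m;
    rewrite geq_max => /andP[Mm M'm]; first exact: M'R.
  exact: MR uvl m Mm.
exists (maxn M n) => m; rewrite geq_max => /andP[Mm nm].
(* The value of [s], [t] at stage [m] is still generated by the pairs of [l], seen in [Kn m]. *)
suff gen theta : congruence theta -> (forall x y, (x, y) \in l ->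
    forall x' y' : Kn m, val x' = val x -> val y' = val y -> theta x' y') ->
    forall u v, vle (s m) (t m) u v -> theta u v.
  apply/conc_leP; apply: gen; first exact: cdd.
  by move=> x y xyl; apply: MR xyl m Mm.
elim: m nm theta {Mm} => [|m IH].
  rewrite leqn0 => /eqP n0; subst n => theta ct_ hl u v.
  by rewrite el; apply: (con_gen_min ct_) => x y xyl; apply: hl xyl _ _ _ _.
rewrite leq_eqVlt ltnS => /orP[/eqP nm|nm] theta ct_ hl u v.
  subst n; rewrite el; apply: (con_gen_min ct_) => x y xyl; exact: hl xyl _ _ _ _.
rewrite (vle_next (coherentW nm cs) (coherentW nm ct)).
apply: (con_gen_min ct_) => _ _ [x [y [exy -> ->]]].
move: x y exy; apply: (IH nm); first exact: preimage_congruence.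
by move=> x y xyl x' y' ex ey; apply: hl xyl _ _ _ _.
Qed.

(** Both inequalities descend to a stage by compactness, and zero values descend because [H]
    reflects zero. The solution for stage [n] lives at stage [n.+1], where its thread starts. *)
Lemma limit_adjoin (o s t j : limit_vlat) : adjoinable o s t j ->
  exists y : limit_vlat, veq j (vjoin y s) /\ veq o (vmeet y t).
Proof.
case=> os ot sj tj /tle_eventually[M1 low] /tle_eventually[M2 up].
have [n1 [co cs ct]] := common o s t.
pose n := maxn (maxn n1 (thread_start j)) (maxn M1 M2).
have n1n : (n1 <= n)%N by rewrite !leq_max leqnn.
have {}co := coherentW n1n co; have {}cs := coherentW n1n cs.
have {}ct := coherentW n1n ct.
have cj : coherent j n by apply: coherentW (threadP j); rewrite !leq_max leqnn orbT.
have at0 (a b : thread) : coherent a n -> coherent b n -> tle a b = \bot ->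
    vle (a n) (b n) = \bot by move=> ca cb; rewrite (tleE ca cb) => /H_eq0.
have [_ _ adj] := gP n.
have [|y [yj yo]] := adj (o n) (s n) (t n) (j n).
  split; try exact: at0.
    by apply: low; rewrite !leq_max leqnn !orbT.
  by apply: up; rewrite !leq_max leqnn !orbT.
have [r [ry rg]] := thread_extension g (fun m => stage_emb (st m) (emb m x0)) y.
have cr : coherent r n.+1 by move=> m nm; rewrite rg //; apply: veq_refl.
pose rt : limit_vlat := Thread cr.
have cS (a : thread) : coherent a n -> coherent a n.+1 by apply: coherentW.
exists rt.
have ej : veq (j n.+1) (vjoin (r n.+1) (s n.+1)).
  rewrite ry; apply: veq_trans (veq_sym (cj n (leqnn n))) _.
  apply: veq_trans yj _; apply: veq_join; [exact: veq_refl|exact: cs].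
have eo : veq (o n.+1) (vmeet (r n.+1) (t n.+1)).
  rewrite ry; apply: veq_trans (veq_sym (co n (leqnn n))) _.
  apply: veq_trans yo _; apply: veq_meet; [exact: veq_refl|exact: ct].
have cjr := coherent_join (cr : coherent rt _) (cS s cs).
have cmr := coherent_meet (cr : coherent rt _) (cS t ct).
have [[ej1 ej2] [eo1 eo2]] := (ej, eo).
split; split; rewrite /= (@tleE n.+1) //; try exact: cS.
- by rewrite /= ej1 H0.
- by rewrite /= ej2 H0.
- by rewrite /= eo1 H0.
- by rewrite /= eo2 H0.
Qed.

End Chain.

(** * The exhausting chain and the final extension *)

(** Step [n] passes to an upper bound of the current index and the index coded by [n], with [i0] in
    place of a missing one. Hence [K_ k] is absorbed at step [(pickle k).+1]. *)
Lemma exhausting_sequence d (K : latticeType d) (I : countType)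
    (K_ : I -> latticeClosed K) (x0 : K) : direct_union K_ ->
  exists i : nat -> I, [/\ x0 \in K_ (i 0%N),
    forall n, {subset K_ (i n) <= K_ (i n.+1)} &
    forall x, exists n, x \in K_ (i n)].
Proof.
case=> _ dirK covK; have [i0 x0i] := covK x0.
have /choice[ub ubP] (p : I * I) : exists k,
    {subset K_ p.1 <= K_ k} /\ {subset K_ p.2 <= K_ k} by apply: dirK.
pose i := nat_rect (fun _ => I) i0 (fun n k => ub (k, odflt i0 (unpickle n))).
exists i; split=> // [n|x]; first exact: (ubP (i n, _)).1.
have [k xk] := covK x; exists (pickle k).+1.
by apply: (ubP (_, _)).2; rewrite /= pickleK.
Qed.

Lemma empty_congruence_preserving d (K : latticeType d) : (K -> False) ->
  congruence_preserving (idfun : {lmorphism K -> K}).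
Proof.
move=> K0; have Keq (a b : conc K) : a = b.
  by apply: conc_inj; apply/funext => x; case: (K0 x).
by split=> //; exists id.
Qed.

Section LimitLattice.
Context {d : Order.disp_t} {K : latticeType d}.
Variables (W : vlat (conc K)) (emb : conc_vlat K -> W).
Hypothesis emb_hom : vhom idfun emb.

Definition vclass_emb (x : K) : vquot W := vclass (emb x).

Fact vclass_emb_homo : {homo vclass_emb : x y / x <= y}.
Proof. by move=> x y xy; rewrite vquot_leE vquot_vleE (vhom_vle emb_hom); apply/eqP/cg_eq0. Qed.

Fact vclass_emb_meet : Order.meet_morphism vclass_emb.
Proof. by move=> x y; rewrite -vclass_meet; apply/vclass_eq/(vhom_meet emb_hom). Qed.

Fact vclass_emb_join : Order.join_morphism vclass_emb.
Proof. by move=> x y; rewrite -vclass_join; apply/vclass_eq/(vhom_join emb_hom). Qed.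

HB.instance Definition _ := Order.isOrderMorphism.Build d K vquot_display (vquot W)
  vclass_emb vclass_emb_homo.
HB.instance Definition _ := Order.isLatticeMorphism.Build d K vquot_display (vquot W)
  vclass_emb vclass_emb_meet vclass_emb_join.

Hypothesis emb_bound : forall t, exists x y : K,
  vle (emb x) t = \bot /\ vle t (emb y) = \bot.
Hypothesis adjoin : forall o s t j : W, adjoinable o s t j ->
  exists y, veq j (vjoin y s) /\ veq o (vmeet y t).

Lemma vquot_extension (x0 : K) :
  exists f : {lmorphism K -> vquot W}, [/\ injective f, congruence_preserving f,
    relatively_complemented (vquot W) & convex_generates (range f)].
Proof.
exists vclass_emb; apply: (valued_extension (w := @vquot_vle _ _ W) x0).
- by move=> a b; rewrite vquot_leE; split=> /eqP.
- by move=> b a c; apply: vle_trans.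
- exact: vquot_vle_joinl.
- exact: vquot_vle_meetr.
- by move=> x y; rewrite vquot_vleE (vhom_vle emb_hom).
- move=> o s t j /eqP os /eqP ot /eqP sj /eqP tj low up.
  have [|n [nj no]] := @adjoin (vrepr o) (vrepr s) (vrepr t) (vrepr j).
    by split.
  exists (vclass n); split.
    by rewrite -[s]vreprK -vclass_join -[j]vreprK; apply/vclass_eq/veq_sym.
  by rewrite -[t]vreprK -vclass_meet -[o]vreprK; apply/vclass_eq/veq_sym.
- move=> a; have [x [y [xa ay]]] := emb_bound (vrepr a); exists x, y.
  by rewrite -[a]vreprK !vquot_leE !vquot_vleE xa ay eqxx.
Qed.

End LimitLattice.

Theorem corollary6p5 (d : Order.disp_t) (K : latticeType d)
    (I : countType) (K_ : I -> latticeClosed K)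
    (K_union : direct_union K_)
    (K_cob : forall i, conditionally_co_brouwerian (conc (sublattice (K_ i)))) :
  exists (d' : Order.disp_t) (L : latticeType d') (f : {lmorphism K -> L}),
    [/\ injective f, congruence_preserving f,
        relatively_complemented L & convex_generates (range f)].
Proof.
(* The construction needs a base point; the empty lattice is its own extension. *)
have [[x0 _]|K0] := pselect (exists x : K, True); last first.
  have {}K0 (x : K) : False by apply: K0; exists x.
  exists d, K, idfun; split=> //; first exact: empty_congruence_preserving.
have [i [x0i subi covi]] := exhausting_sequence x0 K_union.
have mc n := meet_continuous_of (K_cob (i n)).
exists vquot_display.
exists (vquot (limit_vlat (N := fun n => K_ (i n)) subi x0i mc)).
apply: (vquot_extension (emb := limit_emb subi covi x0i mc)) => //.
- exact: limit_emb_hom.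
- exact: limit_bound.
- exact: limit_adjoin.
Qed.
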